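(* Let $p\in(1,2)$ and let $h_0\in C^2([0,1])$ satisfy $h_0(0)=0$, $h_0(r)\in(0,\pi)$ for all $r\in(0,1]$, and $h_0'(0)>0$. Then there exists at most one classical solution $h$, defined in a maximal interval $(0,T)$, to the Dirichlet problem $$h_t=F(h)\ \text{ in }(0,T)\times(0,1),\qquad h(0,r)=h_0(r),\ r\in(0,1),\qquad h(t,1)=h_0(1),\ t\in[0,T).$$ Moreover, the solution $h$ satisfies the following. (a) There exists $\delta=\delta(h_0)\in(0,1)$ such that $$h(t,0)=0,\qquad \delta r\le h(t,r)\le \pi-\delta r,\qquad h_r(t,0)\ge\delta$$ for all $r\in(0,1]$ and $t\in(0,T)$. (b) $h_{rr}(t,0)=0$ and $F(h(t,\cdot))|_{r=1}=0$ for all $t\in[0,T)$.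
   Context: For a function $h$ of $r$ (possibly also depending on $t$) put $$J(h)=h_r^2+\frac{\sin^2h}{r^2},$$ $$A(h)=(p-1)h_r^2h_{rr}+(p-3)\Big(\frac{h_r^2\sin h\cos h}{r^2}-\frac{h_r\sin^2h}{r^3}\Big)+\frac{h_r^3}{r}+\frac{h_{rr}\sin^2h}{r^2}-\frac{\sin^3h\cos h}{r^4},$$ and $F(h)=J(h)^{(p-4)/2}A(h)$. $C^{1,2}$ means once continuously differentiable in $t$ and twice in $r$. A classical solution in $(0,T)$ with initial datum $h_0$ is a function $h\in C^{1,2}([0,T]\times[0,1])$ satisfying the Dirichlet problem pointwise in $[0,T]\times[0,1]$ (at $r=0$ the right-hand side $F(h)$ is understood as its limit as $r\to0^+$). A solution defined in a maximal interval $(0,T)$, $T\le\infty$, is a function on $[0,T)\times[0,1]$ that is a classical solution in $(0,T')$ for every $T'<T$ and cannot be extended beyond $T$ in this sense. *)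

(* Defs.v *)
From mathcomp Require Import all_boot all_order all_algebra.
From mathcomp Require Import all_classical all_reals all_analysis.

Set Implicit Arguments.
Unset Strict Implicit.
Unset Printing Implicit Defensive.

Import Order.TTheory GRing.Theory Num.Theory.
Import numFieldNormedType.Exports.

Local Open Scope classical_set_scope.
Local Open Scope ring_scope.

(* [derivable] and [derive1] are two-sided. Here the difference quotient is
   restricted to D, so that for an interval D the derivative is two-sided at
   interior points and one-sided at the endpoints that belong to D; the values
   of f outside D play no role (for x in D). *)
Definition derivable_in (R : realType) (D : set R) (f : R -> R) (x : R) : Prop :=
  cvg ((f y - f x) / (y - x) @[y --> within D x^']).

Definition derive_in (R : realType) (D : set R) (f : R -> R) (x : R) : R :=
  lim ((f y - f x) / (y - x) @[y --> within D x^']).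

Definition I01 (R : realType) : set R := `[0, 1]%classic.

Definition dr (R : realType) (g : R -> R) : R -> R := derive_in (@I01 R) g.

Definition drr (R : realType) (g : R -> R) : R -> R := dr (dr g).

Definition C2_I01 (R : realType) (g : R -> R) : Prop :=
  [/\ forall r, I01 r -> derivable_in (@I01 R) g r,
      forall r, I01 r -> derivable_in (@I01 R) (dr g) r
    & {within @I01 R, continuous (drr g)}].

Section Operator.
Variables (R : realType) (p : R).

Definition Jop (g : R -> R) (r : R) : R :=
  dr g r ^+ 2 + sin (g r) ^+ 2 / r ^+ 2.

Definition Aop (g : R -> R) (r : R) : R :=
  (p - 1) * dr g r ^+ 2 * drr g r
  + (p - 3) * (dr g r ^+ 2 * sin (g r) * cos (g r) / r ^+ 2
               - dr g r * sin (g r) ^+ 2 / r ^+ 3)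
  + dr g r ^+ 3 / r
  + drr g r * sin (g r) ^+ 2 / r ^+ 2
  - sin (g r) ^+ 3 * cos (g r) / r ^+ 4.

(* Only meaningful for r > 0. Where Jop g r = 0 the library's convention
   0 `^ a = 0 (a != 0) gives the value 0. *)
Definition Fop (g : R -> R) (r : R) : R :=
  Jop g r `^ ((p - 4) / 2) * Aop g r.

End Operator.

(* A function h of (t, r) is curried as h : R -> R -> R, so that h t is the
   profile r |-> h(t, r). *)

Definition rect (R : realType) (T : R) : set (R * R) :=
  (`[0, T]%classic : set R) `*` @I01 R.

Definition dt (R : realType) (T : R) (h : R -> R -> R) (t r : R) : R :=
  derive_in (`[0, T]%classic : set R) (fun s => h s r) t.

Definition C12 (R : realType) (T : R) (h : R -> R -> R) : Prop :=
  [/\ forall t r, rect T (t, r) ->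
        [/\ derivable_in (`[0, T]%classic : set R) (fun s => h s r) t,
            derivable_in (@I01 R) (h t) r
          & derivable_in (@I01 R) (dr (h t)) r],
      {within rect T, continuous (fun z : R * R => h z.1 z.2)},
      {within rect T, continuous (fun z : R * R => dt T h z.1 z.2)},
      {within rect T, continuous (fun z : R * R => dr (h z.1) z.2)}
    & {within rect T, continuous (fun z : R * R => drr (h z.1) z.2)}].

(* Classical solution in (0, T), T finite. No boundary condition is imposed
   at r = 0: there the equation is the limit relation F(h) --> h_t. *)
Definition classical_solution (R : realType) (p : R) (h0 : R -> R) (T : R)
    (h : R -> R -> R) : Prop :=
  [/\ C12 T h,
      forall t r, 0 <= t <= T -> 0 < r <= 1 -> dt T h t r = Fop p (h t) r,
      forall t, 0 <= t <= T -> Fop p (h t) r @[r --> 0^'+] --> dt T h t 0,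
      forall r, 0 < r < 1 -> h 0 r = h0 r
    & forall t, 0 <= t <= T -> h t 1 = h0 1].

Definition solution_until (R : realType) (p : R) (h0 : R -> R) (T : \bar R)
    (h : R -> R -> R) : Prop :=
  (0 < T)%E /\
  forall T' : R, 0 < T' -> (T'%:E < T)%E -> classical_solution p h0 T' h.

Definition maximal_solution (R : realType) (p : R) (h0 : R -> R) (T : \bar R)
    (h : R -> R -> R) : Prop :=
  solution_until p h0 T h /\
  forall (S : \bar R) (k : R -> R -> R),
    solution_until p h0 S k ->
    (forall t r, 0 <= t -> (t%:E < T)%E -> 0 <= r <= 1 -> k t r = h t r) ->
    (S <= T)%E.

(* Main.v *)
(** Everything follows from the maximum principle for [u_t = F(u)] on
    [[0, T] x [0, 1]].

    If [c = h(t, 0)] had [sin c cos c <> 0], then [F(h)] would blow up as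
    [r -> 0]; so [h(t, 0)] lies in a discrete set, and [h(t, 0) = 0] by
    continuity in [t]. The line [delta r] is a strict subsolution, because
    [F(delta r) > 0], and [F(pi - h) = - F(h)]; comparison gives
    [delta r <= h <= pi - delta r]. Then [h_r(t, 0) >= delta > 0], and
    the expansion of [F(h)] at [r = 0] is a nonzero multiple of [h_rr(t, 0)],
    which must vanish since [h_t(t, 0) = 0].

    For uniqueness, write [F = J^q A] with [q = (p - 4) / 2], and compare two
    solutions at a point where [h1 - h2] is a positive maximum in [r]. There the
    first derivatives agree and
    [F(h1) - F(h2) <= J1^q (A1 - A2) + (J1^q - J2^q) A2]. With [k = sin h / r],
    [r^2 dA/dh = (p - 3) (h_r - k cos h)^2 - p k^2 + O(r)], so the first term is
    at most [(- c / r^2 + C / r) (h1 - h2)]; the second one is [O(1 / r) (h1 - h2)]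
    because [A2 = J2^(-q) h_t] is bounded. Hence
    [F(h1) - F(h2) <= K (h1 - h2)] uniformly down to [r = 0]. *)

Require Import Defs.
From mathcomp Require Import all_boot all_order all_algebra.
From mathcomp Require Import all_classical all_reals all_analysis ring lra.

Set Implicit Arguments.
Unset Strict Implicit.
Unset Printing Implicit Defensive.

Import Order.TTheory GRing.Theory Num.Theory.
Import numFieldNormedType.Exports.

Local Open Scope classical_set_scope.
Local Open Scope ring_scope.

(** * Calculus of derivatives relative to a set *)

Definition has_der {R : realType} (D : set R) (f : R -> R) (x l : R) : Prop :=
  (f y - f x) / (y - x) @[y --> within D x^'] --> l.

Lemma within_dnbhsP {R : realType} (D : set R) (x : R) (P : set R) :
  within D x^' P <->
  exists2 d : R, 0 < d & forall y, D y -> y != x -> `|y - x| < d -> P y.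
Proof.
split.
  move=> /nbhs_ballP[d /= d0 H]; exists d => // y Dy yx yd.
  by apply: H => //; rewrite /ball /= distrC.
move=> [d d0 H]; apply/nbhs_ballP; exists d => // y xy yx Dy.
by apply: H => //; rewrite distrC.
Qed.

(** Multiplying the difference quotient by [y - x] gives a form without division, which also holds
    at [y = x]; the later estimates start from it. *)
Lemma has_derP {R : realType} (D : set R) (f : R -> R) (x l : R) :
  has_der D f x l <->
  forall e, 0 < e -> exists2 d : R, 0 < d & forall y, D y -> `|y - x| < d ->
    `|f y - f x - l * (y - x)| <= e * `|y - x|.
Proof.
have E y : y != x ->
    `|f y - f x - l * (y - x)| = `|l - (f y - f x) / (y - x)| * `|y - x|.
  move=> yx; rewrite -normrM distrC; congr (`| _ |).
  by field; rewrite subr_eq0.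
split.
  move=> /cvgrPdist_le H e e0.
  have /within_dnbhsP[d d0 Hd] := H e e0; exists d => // y Dy yd.
  have [->|yx] := eqVneq y x; first by rewrite !subrr mulr0 normr0 subr0 mulr0 normr0.
  by rewrite E// ler_wpM2r// Hd.
move=> H; apply/cvgrPdist_le => e e0.
have [d d0 Hd] := H e e0; apply/within_dnbhsP; exists d => // y Dy yx yd.
have := Hd y Dy yd; rewrite E// ler_pM2r//.
by rewrite normr_gt0 subr_eq0.
Qed.

Lemma has_der_sub {R : realType} (D E : set R) (f : R -> R) (x l : R) :
  D `<=` E -> has_der E f x l -> has_der D f x l.
Proof.
move=> DE /has_derP H; apply/has_derP => e /H[d d0 Hd].
by exists d => // y /DE; apply: Hd.
Qed.

Lemma eq_has_der {R : realType} (D : set R) (f g : R -> R) (x l : R) :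
  D x -> (forall y, D y -> f y = g y) -> has_der D f x l -> has_der D g x l.
Proof.
move=> Dx fg /has_derP H; apply/has_derP => e /H[d d0 Hd].
by exists d => // y Dy; rewrite -!fg//; apply: Hd.
Qed.

Lemma has_der_cvg {R : realType} (D : set R) (f : R -> R) (x l : R) :
  has_der D f x l -> f y @[y --> within D x^'] --> f x.
Proof.
move=> /has_derP H; have [d d0 Hd] := H 1 ltr01.
apply/cvgrPdist_le => e e0; apply/within_dnbhsP.
have l0 : 0 < 1 + `|l| by rewrite ltr_pwDl.
exists (Num.min d (e / (1 + `|l|))); first by rewrite lt_min d0 divr_gt0.
move=> y Dy yx; rewrite lt_min => /andP[yd]; rewrite ltr_pdivlMr// => ye.
have := Hd y Dy yd; rewrite mul1r => H1; rewrite distrC.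
have -> : f y - f x = (f y - f x - l * (y - x)) + l * (y - x) by ring.
apply: le_trans (ler_normD _ _) _; rewrite normrM.
apply: le_trans (lerD H1 (lexx _)) _; rewrite (le_trans _ (ltW ye))//.
by rewrite mulrDr mulr1 [`|l| * _]mulrC.
Qed.

Lemma has_der_cst {R : realType} (D : set R) (c x : R) :
  has_der D (fun=> c) x 0.
Proof.
apply/has_derP => e e0; exists 1 => // y _ _.
by rewrite subrr mul0r subr0 normr0 mulr_ge0// ltW.
Qed.

Lemma has_der_id {R : realType} (D : set R) (x : R) : has_der D id x 1.
Proof.
apply/has_derP => e e0; exists 1 => // y _ _.
by rewrite mul1r subrr normr0 mulr_ge0// ltW.
Qed.

Lemma eq_cvg_has_der {R : realType} (D : set R) (f g : R -> R) (x l : R) :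
  g y @[y --> within D x^'] --> l ->
  (forall y, y != x -> (f y - f x) / (y - x) = g y) -> has_der D f x l.
Proof.
move=> gl fg; apply: (cvg_trans _ gl); apply: near_eq_cvg.
by apply/within_dnbhsP; exists 1 => // y _ yx _; rewrite fg.
Qed.

Lemma has_derM {R : realType} (D : set R) (f g : R -> R) (x l m : R) :
  has_der D f x l -> has_der D g x m ->
  has_der D (fun y => f y * g y) x (f x * m + g x * l).
Proof.
move=> Hf Hg; have Hc := has_der_cvg Hf.
have FF : Filter (within D x^') by exact: within_filter.
have C := cvgD (cvgM Hc Hg) (cvgM (cvg_cst (g x)) Hf).
apply: eq_cvg_has_der (C _ _ _ _) _ => y yx /=; field; by rewrite subr_eq0.
Qed.

Lemma has_derD {R : realType} (D : set R) (f g : R -> R) (x l m : R) :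
  has_der D f x l -> has_der D g x m ->
  has_der D (fun y => f y + g y) x (l + m).
Proof.
move=> Hf Hg; have FF : Filter (within D x^') by exact: within_filter.
have C := cvgD Hf Hg.
apply: eq_cvg_has_der (C _) _ => y yx /=; field; by rewrite subr_eq0.
Qed.

Lemma has_derZ {R : realType} (D : set R) (f : R -> R) (x l c : R) :
  has_der D f x l -> has_der D (fun y => c * f y) x (c * l).
Proof.
by move=> /(has_derM (has_der_cst D c x)); rewrite mulr0 addr0.
Qed.

Lemma has_derB {R : realType} (D : set R) (f g : R -> R) (x l m : R) :
  has_der D f x l -> has_der D g x m ->
  has_der D (fun y => f y - g y) x (l - m).
Proof.
move=> Hf Hg; have /(has_derD Hf) := has_derZ (c := -1) Hg.
rewrite mulN1r; congr (has_der _ _ _ _); by apply/funext => y; rewrite mulN1r.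
Qed.

(** Makes limits within [[a, b]], hence one-sided derivatives, unique. Points of [[a, b]] near [x]
    are found to its right when [x < b] and to its left when [x = b]. *)
Lemma within_dnbhs_itv_proper {R : realType} (a b x : R) :
  a < b -> a <= x <= b -> ProperFilter (within `[a, b] x^').
Proof.
move=> ab /andP[ax xb].
apply: Build_ProperFilter_ex => P /within_dnbhsP[d d0 H].
have [xb'|] := ltP x b.
  exists (x + Num.min (d / 2) (b - x)).
  have m0 : 0 < Num.min (d / 2) (b - x) by rewrite lt_min divr_gt0//= subr_gt0.
  have m1 : Num.min (d / 2) (b - x) <= d / 2 by rewrite ge_min lexx.
  have m2 : Num.min (d / 2) (b - x) <= b - x by rewrite ge_min lexx orbT.
  apply: H; first by rewrite /= in_itv /=; lra.
    lra.
  by rewrite ger0_norm; lra.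
move=> bx; exists (x - Num.min (d / 2) (x - a)).
have m0 : 0 < Num.min (d / 2) (x - a) by rewrite lt_min divr_gt0//= subr_gt0; lra.
have m1 : Num.min (d / 2) (x - a) <= d / 2 by rewrite ge_min lexx.
have m2 : Num.min (d / 2) (x - a) <= x - a by rewrite ge_min lexx orbT.
apply: H; first by rewrite /= in_itv /=; lra.
  lra.
by rewrite ler0_norm; lra.
Qed.

Lemma has_der_uniq {R : realType} (a b : R) (f : R -> R) (x l m : R) :
  a < b -> a <= x <= b -> has_der `[a, b] f x l -> has_der `[a, b] f x m ->
  l = m.
Proof.
move=> ab axb Hl Hm; have P := within_dnbhs_itv_proper ab axb.
have U := @cvg_unique R (@norm_hausdorff R R) _ (fmap_proper_filter _ P) l m.
exact: U Hl Hm.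
Qed.

Lemma has_der_within_continuous {R : realType} (a b : R) (f f' : R -> R) :
  (forall x, a <= x <= b -> has_der `[a, b] f x (f' x)) ->
  {within `[a, b], continuous f}.
Proof.
move=> H; apply/subspace_continuousP => x; rewrite /= in_itv /= => xab.
have /cvgrPdist_le Hc := has_der_cvg (H x xab).
apply/cvgrPdist_le => e e0; have /within_dnbhsP[d d0 Hd] := Hc e e0.
apply/nbhs_ballP; exists d => // y xy Dy.
have [->|yx] := eqVneq y x; first by rewrite subrr normr0 ltW.
by apply: Hd => //; rewrite distrC.
Qed.

(** Increments shorter than the distance from [x] to both endpoints stay in [[a, b]], so at interior
    points the derivative is the two-sided one. This gives access to the mean value theorem. *)
Lemma has_der_is_derive {R : realType} (a b x l : R) (f : R -> R) :
  a < x < b -> has_der `[a, b] f x l -> is_derive x 1 f l.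
Proof.
move=> /andP[ax xb] /cvgrPdist_le H.
suff C : (fun h => h^-1 *: ((f \o shift x) (h *: 1) - f x)) @ 0^' --> l.
  by split; [apply/cvg_ex; exists l|exact: cvg_lim C].
apply/cvgrPdist_le => e e0; have /within_dnbhsP[d d0 Hd] := H e e0.
apply/nbhs_ballP; exists (Num.min d (Num.min (x - a) (b - x))).
  by rewrite /= !lt_min d0 /= !subr_gt0 ax xb.
move=> h; rewrite /ball /= sub0r normrN !lt_min => /and3P[hd ha hb] h0.
have -> : h^-1 *: (f (h *: 1 + x) - f x) =
    (f (h + x) - f x) / (h + x - x).
  by rewrite /GRing.scale /= mulr1 addrK mulrC.
apply: Hd; last by rewrite addrK.
  have := ler_norm h; have := ler_norm (- h); rewrite normrN.
  by rewrite /= in_itv /=; lra.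
by rewrite -subr_eq0 addrK.
Qed.

Lemma has_der_MVT {R : realType} (a b : R) (f f' : R -> R) :
  a < b -> (forall x, a <= x <= b -> has_der `[a, b] f x (f' x)) ->
  exists2 c, a < c < b & f b - f a = f' c * (b - a).
Proof.
move=> ab H; have [||c] := @MVT _ f f' a b ab.
- move=> x; rewrite in_itv /= => /andP[ax xb].
  apply: (@has_der_is_derive _ a b) => //; first by rewrite ax.
  by apply: H; rewrite (ltW ax) ltW.
- exact: has_der_within_continuous H.
by rewrite in_itv /= => cab E; exists c.
Qed.

Lemma is_derive_has_der {R : realType} (D : set R) (x l : R) (f : R -> R) :
  is_derive x 1 f l -> has_der D f x l.
Proof.
move=> [fd fl]; have C : (fun h => h^-1 *: ((f \o shift x) (h *: 1) - f x)) @ 0^' --> l.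
  by rewrite -fl.
move/cvgrPdist_le in C; apply/cvgrPdist_le => e e0.
have /nbhs_ballP[d /= d0 Hd] := C e e0.
apply/within_dnbhsP; exists d => // y _ yx yd.
have := Hd (y - x); rewrite /ball /= sub0r normrN subr_eq0 => /(_ yd yx).
by rewrite /GRing.scale /= mulr1 subrK mulrC.
Qed.

(** * First and second order conditions at a minimum *)

Lemma has_der_ge0_right {R : realType} (a b x l : R) (f : R -> R) :
  a <= x < b -> has_der `[a, b] f x l ->
  (forall y, x < y <= b -> f x <= f y) -> 0 <= l.
Proof.
move=> /andP[ax xb] /has_derP H fmin; rewrite leNgt; apply/negP => l0.
(* With relative error [- l / 2], the increment of [f] over a short length [m] is at most
   [l m / 2 < 0]. *)
have e0 : 0 < - l / 2 by lra.
have [d d0 Hd] := H _ e0.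
pose m := Num.min (d / 2) (b - x).
have m0 : 0 < m by rewrite lt_min divr_gt0//= subr_gt0.
have m1 : m <= d / 2 by rewrite ge_min lexx.
have m2 : m <= b - x by rewrite ge_min lexx orbT.
have fm : f x <= f (x + m) by apply: fmin; lra.
have := Hd (x + m); rewrite addrAC subrr add0r (gtr0_norm m0) /= in_itv /=.
move=> Hm; have : `|f (x + m) - f x - l * m| <= - l / 2 * m by apply: Hm; lra.
by rewrite ler_norml => /andP[_]; nra.
Qed.

Lemma has_der_le0_left {R : realType} (a b x l : R) (f : R -> R) :
  a < x <= b -> has_der `[a, b] f x l ->
  (forall y, a <= y < x -> f x <= f y) -> l <= 0.
Proof.
move=> /andP[ax xb] /has_derP H fmin; rewrite leNgt; apply/negP => l0.
have e0 : 0 < l / 2 by lra.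
have [d d0 Hd] := H _ e0.
pose m := Num.min (d / 2) (x - a).
have m0 : 0 < m by rewrite lt_min divr_gt0//= subr_gt0.
have m1 : m <= d / 2 by rewrite ge_min lexx.
have m2 : m <= x - a by rewrite ge_min lexx orbT.
have fm : f x <= f (x - m) by apply: fmin; lra.
have := Hd (x - m).
rewrite addrAC subrr add0r normrN (gtr0_norm m0) /= in_itv /=.
move=> Hm; have : `|f (x - m) - f x - l * - m| <= l / 2 * m by apply: Hm; lra.
by rewrite ler_norml => /andP[_]; nra.
Qed.

Lemma min_has_der {R : realType} (a b x l : R) (f : R -> R) :
  a < x < b -> has_der `[a, b] f x l ->
  (forall y, a <= y <= b -> f x <= f y) -> l = 0.
Proof.
move=> /andP[ax xb] H fmin; apply/eqP; rewrite eq_le; apply/andP; split.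
  by apply: has_der_le0_left H _ => [|y ?]; [lra|apply: fmin; lra].
by apply: has_der_ge0_right H _ => [|y ?]; [lra|apply: fmin; lra].
Qed.

(** Since [f' x = 0], a value [m < 0] would make [f'] negative just to the right of [x], and the
    mean value theorem would push [f] below its minimum. *)
Lemma min_has_der2 {R : realType} (a b x m : R) (f f' : R -> R) :
  a < x < b -> (forall y, a <= y <= b -> has_der `[a, b] f y (f' y)) ->
  has_der `[a, b] f' x m ->
  (forall y, a <= y <= b -> f x <= f y) -> 0 <= m.
Proof.
move=> axb H /has_derP H2 fmin; have /andP[ax xb] := axb.
rewrite leNgt; apply/negP => m0.
have f'0 : f' x = 0 by apply: min_has_der axb (H _ _) fmin; lra.
have e0 : 0 < - m / 2 by lra.
have [d d0 Hd] := H2 _ e0.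
pose k := Num.min (d / 2) (b - x).
have k0 : 0 < k by rewrite lt_min divr_gt0//= subr_gt0.
have k1 : k <= d / 2 by rewrite ge_min lexx.
have k2 : k <= b - x by rewrite ge_min lexx orbT.
have xk : x < x + k by lra.
have [y|c /andP[xc ck] E] := @has_der_MVT _ x (x + k) f f' xk.
  move=> yx; apply: has_der_sub (H y _); last lra.
  by move=> z; rewrite /= !in_itv /=; lra.
have fxk : f x <= f (x + k) by apply: fmin; lra.
have cx : 0 < c - x by lra.
have := Hd c; rewrite f'0 subr0 (gtr0_norm cx) /= in_itv /= => Hc.
have : `|f' c - m * (c - x)| <= - m / 2 * (c - x) by apply: Hc; lra.
have mc : 0 < - m * (c - x) by rewrite mulr_gt0//; lra.
rewrite ler_norml => /andP[_ fc]; have f'c : 0 < - f' c by lra.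
by have := mulr_gt0 f'c k0; lra.
Qed.

(** * Parabolic minimum principle on a rectangle *)

Lemma compact_rect {R : realType} (a b : R) :
  compact ((`[a, b]%classic : set R) `*` @I01 R).
Proof. by apply: compact_setX; exact: segment_compact. Qed.

(* At a negative minimum of [u e^{-K(t-a)}] one has [u_r = 0], [u_rr >= 0] and
   [u_t <= K u]. *)
Lemma weak_min_principle {R : realType} (K a b : R) (u ut ur urr : R -> R -> R) :
  a < b ->
  {within (`[a, b]%classic : set R) `*` @I01 R,
    continuous (fun z : R * R => u z.1 z.2)} ->
  (forall t r, a <= t <= b -> 0 <= r <= 1 ->
    [/\ has_der `[a, b] (u^~ r) t (ut t r), has_der `[0, 1] (u t) r (ur t r)
      & has_der `[0, 1] (ur t) r (urr t r)]) ->
  (forall r, 0 <= r <= 1 -> 0 <= u a r) ->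
  (forall t, a <= t <= b -> 0 <= u t 0 /\ 0 <= u t 1) ->
  (forall t r, a < t <= b -> 0 < r < 1 -> u t r < 0 ->
    ur t r = 0 -> 0 <= urr t r -> ut t r <= K * u t r -> False) ->
  forall t r, a <= t <= b -> 0 <= r <= 1 -> 0 <= u t r.
Proof.
move=> ab uc ud ua u01 uint.
pose e (z : R * R) := expR (- K * (z.1 - a)).
have ec : {within (`[a, b]%classic : set R) `*` @I01 R, continuous e}.
  apply: continuous_subspaceT => z; apply: continuous_comp.
    apply: cvgMr; apply: cvgB; last exact: cvg_cst.
    exact: cvg_fst.
  exact: continuous_expR.
have wc : {within (`[a, b]%classic : set R) `*` @I01 R,
    continuous (fun z : R * R => e z * u z.1 z.2)}.
  move=> z; exact: (cvgM (ec z) (uc z)).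
have [|[t0 r0]] := compact_EVT_min _ (@compact_rect R a b) wc.
  by exists (a, 0); split; rewrite /I01 /= in_itv /= ?lexx ?(ltW ab) ?ler01.
rewrite inE => -[/=]; rewrite /I01 /= !in_itv /= => t0ab r0I umin.
have {}umin t r : a <= t <= b -> 0 <= r <= 1 ->
    e (t0, r0) * u t0 r0 <= e (t, r) * u t r.
  move=> tab rI; apply: (umin (t, r)); rewrite inE; split => //=.

suff u0 : 0 <= u t0 r0.
  move=> t r tab rI; rewrite -(pmulr_rge0 _ (expR_gt0 (- K * (t - a)))).
  by apply: le_trans (umin t r tab rI); rewrite mulr_ge0// expR_ge0.
rewrite leNgt; apply/negP => u0.
have [t0a|t0a] := eqVneq t0 a.
  by move: u0; rewrite t0a ltNge ua.
have [r00|r00] := eqVneq r0 0.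
  by move: u0; rewrite r00 ltNge (u01 _ t0ab).1.
have [r01|r01] := eqVneq r0 1.
  by move: u0; rewrite r01 ltNge (u01 _ t0ab).2.
have r0i : 0 < r0 < 1.
  by case/andP: r0I => ? ?; rewrite lt_neqAle eq_sym r00 lt_neqAle r01; apply/andP.
have t0i : a < t0 <= b.
  by case/andP: t0ab => ? ?; rewrite lt_neqAle eq_sym t0a; apply/andP.
have [Ht Hr Hrr] := ud _ _ t0ab r0I.
have umin_r r : 0 <= r <= 1 -> u t0 r0 <= u t0 r.
  move=> rI; rewrite -(ler_pM2l (expR_gt0 (- K * (t0 - a)))).
  exact: (umin _ _ t0ab rI).
apply: (uint _ _ t0i r0i u0).
- exact: min_has_der r0i Hr umin_r.
- apply: min_has_der2 r0i _ Hrr umin_r => y yI.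
  by have [] := ud _ _ t0ab yI.
have He : has_der `[a, b] (fun t => e (t, r0)) t0 (- K * e (t0, r0)).
  apply: is_derive_has_der; rewrite /e /=.
  have Hl : is_derive (t0 : R) 1 (fun t : R => - K * (t - a)) (- K).
    by apply: is_derive_eq; rewrite subr0 [LHS]mulr1.
  have := @is_derive1_comp R expR _ t0 _ _ (is_derive_expR _) Hl.
  by rewrite mulrC.
(* The minimum may lie on the final face [t0 = b], so only earlier times are compared; the sign of
   the left derivative of [e u] is that of [ut - K u]. *)
have := has_der_le0_left t0i (has_derM He Ht) _.
rewrite [_ + _ * (- K * _)](_ : _ = e (t0, r0) * (ut t0 r0 - K * u t0 r0)); last by ring.
rewrite pmulr_rle0 ?expR_gt0// subr_le0; apply => t tt0.
by apply: umin => //; lra.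
Qed.

(** * Elementary bounds for sine, cosine and powers *)

Lemma is_derive_MVT {R : realType} (a b : R) (f f' : R -> R) :
  a < b -> (forall x, a <= x <= b -> is_derive x 1 f (f' x)) ->
  exists2 c, a < c < b & f b - f a = f' c * (b - a).
Proof.
by move=> ab H; apply: has_der_MVT => // x /H; exact: is_derive_has_der.
Qed.

Lemma cos_ge_cos1 {R : realType} (x : R) : 0 <= x <= 1 -> cos 1 <= cos x.
Proof.
move=> /andP[x0]; rewrite le_eqVlt => /predU1P[->//|x1].
have pi2 := @pi_ge2 R.
have [c cx E] := @is_derive_MVT R x 1 cos (fun z => - sin z) x1 (fun z _ => is_derive_cos z).
have : 0 < sin c by apply: sin_gt0_pi; lra.
by move=> sc; nra.
Qed.

Lemma sin_ge_cos1M {R : realType} (x : R) : 0 <= x <= 1 -> cos 1 * x <= sin x.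
Proof.
move=> /andP[]; rewrite le_eqVlt => /predU1P[<- _|x0 x1]; first by rewrite mulr0 sin0.
have [c cx E] := @is_derive_MVT R 0 x sin cos x0 (fun z _ => is_derive_sin z).
move: E; rewrite sin0 !subr0 => ->; rewrite ler_wpM2r ?cos_ge_cos1//; lra.
Qed.

Lemma sin_lex {R : realType} (x : R) : 0 <= x -> sin x <= x.
Proof.
rewrite le_eqVlt => /predU1P[<-|x0]; first by rewrite sin0.
have [c cx E] := @is_derive_MVT R 0 x sin cos x0 (fun z _ => is_derive_sin z).
move: E; rewrite sin0 !subr0 => ->; rewrite ler_piMl ?cos_le1// ltW//.
Qed.

Lemma sin_lipschitz {R : realType} (x y : R) : x < y -> `|sin y - sin x| <= y - x.
Proof.
move=> xy.
have [c cx ->] := @is_derive_MVT R x y sin cos xy (fun z _ => is_derive_sin z).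
rewrite normrM (gtr0_norm (_ : 0 < y - x)) ?subr_gt0//.
by rewrite ler_piMl ?subr_ge0 ?(ltW xy)// ler_norml cos_le1 cos_geN1.
Qed.

Lemma sinpiB {R : realType} (x : R) : sin (pi - x) = sin x.
Proof. by rewrite sinB sinpi cospi; ring. Qed.

Lemma cospiB {R : realType} (x : R) : cos (pi - x) = - cos x.
Proof. by rewrite cosB sinpi cospi; ring. Qed.

(** Sine increases up to [pi / 2]; a larger [h] is reflected to [pi - h], which has the same
    sine. *)
Lemma le_sin_itv {R : realType} (x h : R) :
  0 <= x -> x <= h <= pi - x -> sin x <= sin h.
Proof.
have key k : 0 <= x -> x <= k <= pi / 2 -> sin x <= sin k.
  move=> x0 /andP[]; rewrite le_eqVlt => /predU1P[->//|xk k2].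
  have [c cx E] := @is_derive_MVT R x k sin cos xk (fun z _ => is_derive_sin z).
  have : 0 <= cos c by apply: cos_ge0_pihalf; have := @pi_ge0 R; lra.
  by move=> c0; rewrite -subr_ge0 E mulr_ge0// subr_ge0 ltW.
move=> x0 xh; have [h2|h2] := leP h (pi / 2); first by apply: key => //; lra.
by rewrite -(sinpiB h); apply: key => //; lra.
Qed.

(** Mean value theorem: for [q <= 0] the derivative [q z^(q - 1)] is largest in absolute value at
    the left end [a]. *)
Lemma powR_diff_le {R : realType} (q a x y : R) : q <= 0 -> 0 < a -> a <= x -> a <= y ->
  `|x `^ q - y `^ q| <= `|q| * a `^ (q - 1) * `|x - y|.
Proof.
move=> q0 a0.
have key u v : a <= u -> u < v ->
    `|v `^ q - u `^ q| <= `|q| * a `^ (q - 1) * `|v - u|.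
  move=> au uv.
  have [z uz|c cx ->] := @is_derive_MVT R u v (fun z => z `^ q) (fun z => q * z `^ (q - 1)) uv.
    by apply: is_derive1_powR; lra.
  rewrite !normrM ler_wpM2r// ler_wpM2l// ger0_norm ?powR_ge0//.
  rewrite -(opprB 1 q) !powRN lef_pV2 ?posrE ?powR_gt0//; [|lra..].
  by apply: ge0_ler_powR; rewrite ?nnegrE; lra.
move=> ax ay; have [->|] := eqVneq x y; first by rewrite !subrr normr0 mulr0.
rewrite neq_lt => /orP[xy|yx]; last exact: key.
by rewrite distrC (distrC x); apply: key.
Qed.

(** * Pointwise algebra of the operator *)

(** The expression [A(h)] with [y], [b], [s], [c] standing for [h_r], [h_rr], [sin h], [cos h].
    Decoupling them allows varying [h] while the derivatives stay frozen. *)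
Definition Aalg {R : realType} (p y b s c r : R) : R :=
  (p - 1) * y ^+ 2 * b
  + (p - 3) * (y ^+ 2 * s * c / r ^+ 2 - y * s ^+ 2 / r ^+ 3)
  + y ^+ 3 / r + b * s ^+ 2 / r ^+ 2 - s ^+ 3 * c / r ^+ 4.

(** Passing from [h] to [pi - h] flips the signs of [h_r], [h_rr] and [cos h] and keeps [sin h]. *)
Lemma Aalg_opp {R : realType} (p y b s c r : R) :
  Aalg p (- y) (- b) s (- c) r = - Aalg p y b s c r.
Proof. by rewrite /Aalg; ring. Qed.

(** With [X = d r], [r^4 A] is a nonnegative multiple of [b] plus
    [(3 - p) X s (s - X c) + X^3 - s^3 c], which is positive. This makes the line [d r] a strict
    barrier; negative [s] is included because the sign of a solution is not known when the barrier
    is applied. *)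
Lemma Aalg_gt0 {R : realType} (p d b s c r : R) :
  1 < p < 2 -> 0 < r -> 0 < d -> 0 <= b -> s < d * r -> 0 <= c <= 1 ->
  0 < Aalg p d b s c r.
Proof.
move=> p12 r0 d0 b0 sX c01; set X := d * r in sX.
have X0 : 0 < X by rewrite mulr_gt0.
have -> : Aalg p d b s c r = (r ^+ 2 * b * ((p - 1) * d ^+ 2 * r ^+ 2 + s ^+ 2)
    + ((3 - p) * (X * s * (s - X * c)) + X ^+ 3 - s ^+ 3 * c)) / r ^+ 4.
  by rewrite /Aalg /X; field; rewrite gt_eqF.
rewrite divr_gt0 ?exprn_gt0// ltr_wpDl//.
  rewrite !mulr_ge0 ?exprn_ge0 ?(ltW r0)// addr_ge0 ?sqr_ge0//.
  by rewrite !mulr_ge0 ?sqr_ge0 ?exprn_ge0 ?ltW//; lra.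
have X3 : 0 < X ^+ 3 by rewrite exprn_gt0.
have [s0|s0] := leP 0 s; last first.
  have a1 : 0 <= X * - s * (- s + X * c).
    by rewrite !mulr_ge0 ?addr_ge0 ?mulr_ge0//; lra.
  have a2 : 0 <= (3 - p) * (X * - s * (- s + X * c)) by rewrite mulr_ge0//; lra.
  have a3 : 0 <= (- s) ^+ 3 * c by rewrite mulr_ge0 ?exprn_ge0//; lra.
  have -> : (3 - p) * (X * s * (s - X * c)) + X ^+ 3 - s ^+ 3 * c =
     (3 - p) * (X * - s * (- s + X * c)) + X ^+ 3 + (- s) ^+ 3 * c by ring.
  lra.
have s3 : s ^+ 3 * c <= s ^+ 3 by rewrite ler_piMr ?exprn_ge0//; lra.
have sX3 : s ^+ 3 < X ^+ 3 by rewrite ltr_pXn2r ?nnegrE//; lra.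
have [sc|sc] := leP (X * c) s.
  have a1 : 0 <= (3 - p) * (X * s * (s - X * c)).
    by rewrite !mulr_ge0//; lra.
  lra.
(* Here [s < X c]. As [3 - p < 2] and [c <= 1], the negative term is at least [- 2 X s (X - s)], and
   [X^3 - s^3 - 2 X s (X - s) = (X - s) ((X - s)^2 + X s)]. *)
have a1 : 0 <= (p - 1) * (X * s * (X * c - s)) by rewrite !mulr_ge0//; lra.
have a2 : 0 <= X ^+ 2 * s * (1 - c) by rewrite !mulr_ge0//; lra.
have a3 : 0 < (X - s) * ((X - s) ^+ 2 + X * s).
  by rewrite mulr_gt0 ?subr_gt0// ltr_pwDl ?exprn_gt0 ?subr_gt0// mulr_ge0// ltW.
nra.
Qed.

Lemma is_derive_Aalg {R : realType} (p y b r h : R) : r != 0 ->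
  is_derive h 1 (fun x : R => Aalg p y b (sin x) (cos x) r)
    ((p - 3) * (y ^+ 2 * (cos h ^+ 2 - sin h ^+ 2) / r ^+ 2
                - 2 * y * sin h * cos h / r ^+ 3)
     + 2 * b * sin h * cos h / r ^+ 2
     - (3 * sin h ^+ 2 * cos h ^+ 2 - sin h ^+ 4) / r ^+ 4).
Proof.
move=> r0.
have -> : (fun x : R => Aalg p y b (sin x) (cos x) r) =
    (fun x => ((p - 1) * y ^+ 2 * b + y ^+ 3 / r)
      + ((p - 3) * y ^+ 2 / r ^+ 2) * (sin x * cos x)
      + (b / r ^+ 2 - (p - 3) * y / r ^+ 3) * (sin x * sin x)
      - r ^- 4 * (sin x * sin x * sin x * cos x)).
  by apply/funext => x; rewrite /Aalg; field.
apply: is_derive_eq; rewrite /GRing.scale /=.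
by field.
Qed.

(** Mean value theorem in [h] with [y] and [b] frozen: the dominant part of the derivative is
    negative of order [r^-2], because [sin h / r] stays above [m]. *)
Lemma Aalg_diff_le {R : realType} (p m M r y b h1 h2 : R) :
  1 < p < 2 -> 0 < m -> 0 < r <= 1 -> `|y| <= M -> `|b| <= M ->
  h2 < h1 -> (forall h, h2 <= h <= h1 -> m * r <= sin h <= M * r) ->
  Aalg p y b (sin h1) (cos h1) r - Aalg p y b (sin h2) (cos h2) r <=
    (- m ^+ 2 + r * (2 * M ^+ 2 + 7 * M ^+ 4)) / r ^+ 2 * (h1 - h2).
Proof.
move=> p12 m0 /andP[r0 r1] yM bM h21 hs.
have rn0 : r != 0 by rewrite gt_eqF.
have [h /andP[h2h hh1] ->] := is_derive_MVT h21 (fun h _ => is_derive_Aalg p y b h rn0).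
rewrite ler_pM2r ?subr_gt0//.
have /andP[] : m * r <= sin h <= M * r by apply: hs; lra.
have := cos2Dsin2 h; move: (sin h) (cos h) => s c cs ms sM.
pose k := s / r; have E : s = k * r by rewrite /k divfK.
rewrite {}E !ler_pM2r// in ms sM cs *; move: k => k in ms sM cs *.
have -> : (p - 3) * (y ^+ 2 * (c ^+ 2 - (k * r) ^+ 2) / r ^+ 2
     - 2 * y * (k * r) * c / r ^+ 3) + 2 * b * (k * r) * c / r ^+ 2
    - (3 * (k * r) ^+ 2 * c ^+ 2 - (k * r) ^+ 4) / r ^+ 4 =
  ((p - 3) * (y ^+ 2 * (c ^+ 2 - (k * r) ^+ 2) - 2 * y * k * c)
    + 2 * b * k * c * r - (3 * k ^+ 2 * c ^+ 2 - k ^+ 4 * r ^+ 2)) / r ^+ 2.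
  by field.
rewrite ler_pM2r ?invr_gt0 ?exprn_gt0//.
have M0 : 0 <= M by apply: le_trans yM.
have k0 : 0 < k by lra.
have c1 : `|c| <= 1.
  by rewrite -(@ler_pXn2r _ 2) ?nnegrE// expr1n real_normK ?num_real//; nra.
have k2 : k ^+ 2 <= M ^+ 2 by rewrite ler_pXn2r ?nnegrE// ltW.
have mk2 : m ^+ 2 <= k ^+ 2 by rewrite ler_pXn2r ?nnegrE// ltW.
have y2 : y ^+ 2 <= M ^+ 2.
  by rewrite -[y ^+ 2]real_normK ?num_real// ler_pXn2r ?nnegrE.
have k4 : k ^+ 4 <= M ^+ 4 by rewrite ler_pXn2r ?nnegrE// ltW.
have r2 : r ^+ 2 <= r by rewrite expr2 ler_piMl// ltW.
have bkc : b * k * c <= M ^+ 2.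
  apply: le_trans (ler_norm _) _; rewrite !normrM (gtr0_norm k0) expr2.
  by rewrite -[leRHS]mulr1 ler_pM// ?mulr_ge0 ?normr_ge0 ?(ltW k0)// ler_pM// ltW.
have y2k2 : y ^+ 2 * k ^+ 2 * r ^+ 2 <= M ^+ 4 * r.
  rewrite (_ : M ^+ 4 = M ^+ 2 * M ^+ 2); last by ring.
  apply: ler_pM => //; [by rewrite mulr_ge0 ?sqr_ge0|exact: sqr_ge0|].
  by apply: ler_pM; rewrite ?sqr_ge0.
have k4r : k ^+ 4 * r ^+ 2 <= M ^+ 4 * r.
  by apply: ler_pM => //; rewrite exprn_ge0// ltW.
have bkcr : b * k * c * r <= M ^+ 2 * r by rewrite ler_wpM2r// ltW.
have sq : 0 <= (3 - p) * (y - k * c) ^+ 2 by rewrite mulr_ge0 ?sqr_ge0//; lra.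
have e1 : (3 - p) * (y ^+ 2 * k ^+ 2 * r ^+ 2) <= 2 * (M ^+ 4 * r).
  apply: ler_pM => //; [lra|by rewrite -!exprMn sqr_ge0|lra].
have e2 : (1 + p) * (k ^+ 4 * r ^+ 2) <= 3 * (M ^+ 4 * r).
  apply: ler_pM => //; [lra|by rewrite mulr_ge0 ?exprn_ge0 ?(ltW k0) ?(ltW r0)|lra].
have e3 : m ^+ 2 <= p * k ^+ 2.
  by apply: le_trans mk2 _; rewrite ler_peMl ?sqr_ge0//; lra.
(* Using [c^2 = 1 - k^2 r^2], a negative square and [- p k^2 <= - m^2] split off. The other three
   terms are at most [4 M^4 r], [2 M^2 r] and [3 M^4 r], whence the constants [2] and [7]. *)
have -> : (p - 3) * (y ^+ 2 * (c ^+ 2 - (k * r) ^+ 2) - 2 * y * k * c)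
    + 2 * b * k * c * r - (3 * k ^+ 2 * c ^+ 2 - k ^+ 4 * r ^+ 2) =
  - ((3 - p) * (y - k * c) ^+ 2) - p * k ^+ 2
  + 2 * ((3 - p) * (y ^+ 2 * k ^+ 2 * r ^+ 2)) + 2 * (b * k * c * r)
  + (1 + p) * (k ^+ 4 * r ^+ 2).
  have c2 : c ^+ 2 = 1 - (k * r) ^+ 2 by rewrite -cs; ring.
  have -> : (y - k * c) ^+ 2 = y ^+ 2 - 2 * y * k * c + k ^+ 2 * (1 - (k * r) ^+ 2).
    by rewrite -c2; ring.
  by rewrite c2; ring.
lra.
Qed.

Definition Falg {R : realType} (p y b s c r : R) : R :=
  (y ^+ 2 + s ^+ 2 / r ^+ 2) `^ ((p - 4) / 2) * Aalg p y b s c r.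

Lemma le_powR_npos {R : realType} (q x y : R) : q <= 0 -> 0 < x -> x <= y ->
  y `^ q <= x `^ q.
Proof.
move=> q0 x0 xy; rewrite -(opprK q) (powRN y (- q)) (powRN x (- q)) lef_pV2 ?posrE ?powR_gt0//; [|lra..].
by apply: ge0_ler_powR; rewrite ?nnegrE; lra.
Qed.

(** Ellipticity: the coefficient of [b] is [(p - 1) y^2 + s^2 / r^2 >= 0]. *)
Lemma Aalg_le {R : realType} (p y b1 b2 s c r : R) : 1 < p -> b1 <= b2 ->
  Aalg p y b1 s c r <= Aalg p y b2 s c r.
Proof.
move=> p1 b12; rewrite -subr_ge0.
have -> : Aalg p y b2 s c r - Aalg p y b1 s c r =
   (b2 - b1) * ((p - 1) * y ^+ 2 + s ^+ 2 / r ^+ 2) by rewrite /Aalg; ring.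
rewrite mulr_ge0 ?subr_ge0// addr_ge0// ?divr_ge0 ?sqr_ge0//.
by rewrite mulr_ge0 ?sqr_ge0// subr_ge0 ltW.
Qed.

(** One-sided Lipschitz bound for two profiles with a common slope [y] at [r]. [K] is uniform down
    to [r = 0] because the favourable [r^-2] term absorbs the errors of order [1 / r]. *)
Lemma Falg_diff_le {R : realType} (p m M : R) : 1 < p < 2 -> 0 < m -> m <= M ->
  exists K : R, forall r y b1 b2 h1 h2 : R,
    0 < r <= 1 -> `|y| <= M -> `|b2| <= M -> b1 <= b2 -> h2 < h1 ->
    (forall h, h2 <= h <= h1 -> m * r <= sin h <= M * r) ->
    `|Falg p y b2 (sin h2) (cos h2) r| <= M ->
    Falg p y b1 (sin h1) (cos h1) r - Falg p y b2 (sin h2) (cos h2) r <=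
    K * (h1 - h2).
Proof.
move=> p12 m0 mM; have M0 : 0 < M by lra.
pose q := (p - 4) / 2; have q0 : q <= 0 by rewrite /q; lra.
(* Since [m^2 <= J <= 2 M^2] and [q <= 0], these are the lower and upper bounds of [J^q]. *)
pose a := (2 * M ^+ 2) `^ q; pose B := (m ^+ 2) `^ q.
have a0 : 0 < a by rewrite powR_gt0 ?mulr_gt0 ?exprn_gt0.
pose C := 2 * M ^+ 2 + 7 * M ^+ 4.
have C0 : 0 <= C by rewrite addr_ge0 ?mulr_ge0 ?exprn_ge0 ?(ltW M0).
(* Factors bounding [(J1^q - J2^q) A2]: the Lipschitz constant of the power, the bound of
   [(s1 + s2) / r], and the bound of [A2]. *)
pose E := `|q| * (m ^+ 2) `^ (q - 1) * (2 * M) * (M / a).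
pose D := B * C + E.
(* Chosen so that [D r - a m^2 <= K r^2] for every [r >= 0]; the difference is shown nonnegative at
   the end by completing a square. *)
exists (D ^+ 2 / (a * m ^+ 2)) => r y b1 b2 h1 h2 /andP[r0 r1] yM bM b12 h21 hs F2.
have u0 : 0 < h1 - h2 by rewrite subr_gt0.
have := hs h1; have := hs h2; have := sin_lipschitz h21.
have := Aalg_diff_le p12 m0 _ yM bM h21 hs; rewrite r0 r1 => /(_ isT).
move: F2; rewrite /Falg -/q.
move: (sin h1) (sin h2) (cos h1) (cos h2) => s1 s2 c1 c2.
set A1' := Aalg p y b2 s1 c1 r; set A1 := Aalg p y b1 s1 c1 r.
set A2 := Aalg p y b2 s2 c2 r.
have A11 : A1 <= A1' by apply: Aalg_le => //; lra.
set J1 := y ^+ 2 + s1 ^+ 2 / _; set J2 := y ^+ 2 + _ => F2 A12 s12 hs2 hs1.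
have {hs2} /andP[ms2 sM2] : m * r <= s2 <= M * r by apply: hs2; lra.
have {hs1} /andP[ms1 sM1] : m * r <= s1 <= M * r by apply: hs1; lra.
have Jb s : m * r <= s -> s <= M * r ->
    m ^+ 2 <= y ^+ 2 + s ^+ 2 / r ^+ 2 <= 2 * M ^+ 2.
  move=> ms sM; have mr : 0 <= m * r by rewrite mulr_ge0 ?ltW.
  have y2 : y ^+ 2 <= M ^+ 2.
    by rewrite -[y ^+ 2]real_normK ?num_real// ler_pXn2r ?nnegrE ?(ltW M0).
  have s2M : s ^+ 2 / r ^+ 2 <= M ^+ 2.
    rewrite ler_pdivrMr ?exprn_gt0// -exprMn ler_pXn2r ?nnegrE//; lra.
  have s2m : m ^+ 2 <= s ^+ 2 / r ^+ 2.
    rewrite ler_pdivlMr ?exprn_gt0// -exprMn ler_pXn2r ?nnegrE//; lra.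
  have := sqr_ge0 y; lra.
have /andP[mJ1 JM1] := Jb _ ms1 sM1; have /andP[mJ2 JM2] := Jb _ ms2 sM2.
rewrite -/J1 -/J2 in mJ1 mJ2 JM1 JM2.
have m2 : 0 < m ^+ 2 by rewrite exprn_gt0.
have aJ1 : a <= J1 `^ q by apply: le_powR_npos => //; lra.
have aJ2 : a <= J2 `^ q by apply: le_powR_npos => //; lra.
have JB1 : J1 `^ q <= B by apply: le_powR_npos.
have r2 : 0 < r ^+ 2 by rewrite exprn_gt0.
have J12 : `|J1 - J2| <= 2 * M * ((h1 - h2) / r).
  have -> : J1 - J2 = (s1 - s2) * ((s1 + s2) / r) / r.
    by rewrite /J1 /J2; field; rewrite gt_eqF.
  have ri : 0 < r^-1 by rewrite invr_gt0.
  rewrite normrM (gtr0_norm ri) [leRHS]mulrA ler_pM2r//.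
  rewrite normrM [2 * M * _]mulrC ler_pM//.
  have := mulr_gt0 m0 r0 => mr0.
  rewrite ger0_norm ?divr_ge0 ?ler_pdivrMr//; lra.
(* The explicit formula for [A2] is singular at [r = 0]; the bound comes from that on [F = J2^q A2]
   instead. *)
have A2M : `|A2| <= M / a.
  have J2q : 0 < J2 `^ q by lra.
  have -> : A2 = (J2 `^ q * A2) / J2 `^ q by field; rewrite gt_eqF.
  rewrite normrM ler_pM// normfV lef_pV2 ?posrE ?normr_gt0 ?gt_eqF//.
  by rewrite gtr0_norm.
have t3 : (J1 `^ q - J2 `^ q) * A2 <= r * E / r ^+ 2 * (h1 - h2).
  have -> : r * E / r ^+ 2 * (h1 - h2) = (`|q| * (m ^+ 2) `^ (q - 1) *
     (2 * M * ((h1 - h2) / r))) * (M / a).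
    by rewrite /E; field; rewrite !gt_eqF.
  apply: le_trans (ler_norm _) _; rewrite normrM ler_pM//.
  apply: le_trans (powR_diff_le q0 m2 mJ1 mJ2) _.
  by rewrite ler_wpM2l// mulr_ge0// powR_ge0.
have t2 : J1 `^ q * (A1' - A2) <=
    (- a * m ^+ 2 + r * (B * C)) / r ^+ 2 * (h1 - h2).
  have Jq : 0 < J1 `^ q by lra.
  apply: le_trans (_ : J1 `^ q * ((- m ^+ 2 + r * C) / r ^+ 2 * (h1 - h2)) <= _).
    by rewrite ler_pM2l.
  rewrite !mulrA ler_pM2r// ler_pM2r ?invr_gt0// mulrDr.
  rewrite lerD//; first by have := ler_wpM2r (ltW m2) aJ1; lra.
  by have := ler_wpM2r (mulr_ge0 (ltW r0) C0) JB1; lra.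
have t1 : J1 `^ q * A1 <= J1 `^ q * A1' by rewrite ler_wpM2l// powR_ge0.
have am : 0 < a * m ^+ 2 by rewrite mulr_gt0.
have -> : J1 `^ q * A1 - J2 `^ q * A2 = (J1 `^ q * A1 - J1 `^ q * A1')
   + (J1 `^ q * (A1' - A2) + (J1 `^ q - J2 `^ q) * A2) by ring.
apply: le_trans (_ : 0 + ((- a * m ^+ 2 + r * (B * C)) / r ^+ 2 * (h1 - h2) +
  r * E / r ^+ 2 * (h1 - h2)) <= _).
  by rewrite !lerD// subr_le0.
rewrite add0r -!mulrDl ler_pM2r// ler_pdivrMr// -addrA -mulrDr -/D.
rewrite -subr_ge0 (_ : _ - _ =
  ((a * m ^+ 2 - r * D) ^+ 2 + a * m ^+ 2 * r * D) / (a * m ^+ 2)); last first.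
  by field; rewrite !gt_eqF.
have D0 : 0 <= D.
  by rewrite addr_ge0 ?mulr_ge0 ?powR_ge0 ?invr_ge0 ?(ltW M0) ?(ltW a0).
by rewrite divr_ge0 ?(ltW am)// addr_ge0 ?sqr_ge0 ?mulr_ge0 ?(ltW r0) ?(ltW am) ?(ltW a0) ?(ltW m0).
Qed.

(** * Linear barriers for the flow *)

(** The derivatives are separate arguments, so that the reflected flow [pi - h] fits the same
    interface with the negated derivatives. *)
Definition flow_data {R : realType} (p T : R) (h ht hr hrr : R -> R -> R) : Prop :=
  [/\ {within rect T, continuous (fun z : R * R => h z.1 z.2)},
      forall t r, 0 <= t <= T -> 0 <= r <= 1 ->
        [/\ has_der `[0, T] (h^~ r) t (ht t r), has_der `[0, 1] (h t) r (hr t r)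
          & has_der `[0, 1] (hr t) r (hrr t r)]
    & forall t r, 0 <= t <= T -> 0 < r <= 1 ->
        ht t r = Falg p (hr t r) (hrr t r) (sin (h t r)) (cos (h t r)) r].

Lemma rect_bounded {R : realType} (T : R) (f : R * R -> R) : 0 <= T ->
  {within rect T, continuous f} ->
  exists M : R, forall t r, 0 <= t <= T -> 0 <= r <= 1 -> `|f (t, r)| <= M.
Proof.
move=> T0 fc.
have ne : @rect R T !=set0.
  by exists (0, 0); split; rewrite /I01 /= in_itv /= lexx ?T0 ?ler01.
have [c _ cmax] := compact_EVT_max ne (@compact_rect R 0 T) fc.
have [d _ dmin] := compact_EVT_min ne (@compact_rect R 0 T) fc.
exists (Num.max `|f c| `|f d|) => t r tT rI.
have tr : (t, r) \in @rect R T.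
  by rewrite inE; split; rewrite /I01 /= in_itv.
have := cmax _ tr; have := dmin _ tr; have := ler_norm (f c).
have := ler_norm (- f d); rewrite normrN le_max ler_norml => *.
have [fcd|fcd] := leP `|f c| `|f d|; rewrite ler_norml.
  by apply/orP; right; lra.
by apply/orP; left; lra.
Qed.

(** Turns the upper barrier [pi - d r] for [h] into the lower barrier [d r] for [pi - h]. *)
Lemma flow_data_refl {R : realType} (p T : R) (h ht hr hrr : R -> R -> R) :
  flow_data p T h ht hr hrr ->
  flow_data p T (fun t r => pi - h t r) (fun t r => - ht t r)
    (fun t r => - hr t r) (fun t r => - hrr t r).
Proof.
have hN D f x l : has_der D f x l -> has_der D (fun y : R => - f y) x (- l).
  move=> H; have := has_derB (has_der_cst D 0 x) H; rewrite sub0r.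
  by congr (has_der _ _ _ _); apply/funext => y; rewrite sub0r.
have hpi D f x l : has_der D f x l -> has_der D (fun y : R => pi - f y) x (- l).
  by move=> H; have := has_derB (has_der_cst D pi x) H; rewrite sub0r.
move=> [hc hd he]; split.
- by apply: within_continuousB hc; apply: continuous_subspaceT => z; exact: cvg_cst.
- move=> t r tT rI; have [? ? ?] := hd t r tT rI.
  by split; [apply: hpi|apply: hpi|apply: hN].
- move=> t r tT rI; rewrite he// sinpiB cospiB /Falg Aalg_opp sqrrN.
  by rewrite mulrN.
Qed.

Lemma itv_sub {R : realType} (a b c d : R) : c <= a -> b <= d ->
  `[a, b]%classic `<=` `[c, d]%classic.
Proof. by move=> ca bd z; rewrite /= !in_itv /=; lra. Qed.

(** The strict inequality [F > 0] below the line requires [cos k >= 0] and [sin k < d r]. On a time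
    slab of height at most [1 / M] the solution cannot fall below [-1], which secures both. *)
Lemma flow_barrier_step {R : realType} (p T d a b M : R) (k kt kr krr : R -> R -> R) :
  1 < p < 2 -> 0 < d < 1 -> 0 <= a -> a < b -> b <= T -> M * (b - a) <= 1 ->
  flow_data p T k kt kr krr ->
  (forall t r, 0 <= t <= T -> 0 <= r <= 1 -> `|kt t r| <= M) ->
  (forall t, 0 <= t <= T -> 0 <= k t 0 /\ d <= k t 1) ->
  (forall r, 0 <= r <= 1 -> d * r <= k a r) ->
  forall t r, a <= t <= b -> 0 <= r <= 1 -> d * r <= k t r.
Proof.
move=> p12 d01 a0 ab bT Mba [kc kd ke] ktM k01 ka t r tab rI.
have lb s q : a < s <= b -> 0 <= q <= 1 -> -1 <= k s q.
  move=> sab qI; have asb : a < s by lra.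
  have [x xI|c cs E] := @has_der_MVT _ a s (k^~ q) (kt^~ q) asb.
    apply: (@has_der_sub _ _ `[0, T]); first by apply: itv_sub; lra.
    by have [] := kd x q _ qI; first lra.
  have cT : 0 <= c <= T by lra.
  have /ler_normlP[_ ktc] := ktM c q cT qI; have := ka q qI.
  have /ler_normlP[ktc' _] := ktM c q cT qI.
  have M0 : 0 <= M by apply: le_trans (ktM c q cT qI).
  have : kt c q * (s - a) >= - 1.
    have : - M * (s - a) <= kt c q * (s - a) by rewrite ler_wpM2r; lra.
    have : M * (s - a) <= M * (b - a) by rewrite ler_wpM2l; lra.
    lra.
  have : 0 <= d * q by rewrite mulr_ge0; lra.
  lra.
rewrite -subr_ge0.
apply: (@weak_min_principle _ 0 a b (fun t r => k t r - d * r) kt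
  (fun t r => kr t r - d) krr) => //.
- apply: within_continuousB; last first.
    apply: continuous_subspaceT => z; apply: cvgMr; exact: cvg_snd.
  apply: continuous_subspaceW kc; apply: setSX => //.
  by apply: itv_sub.
- move=> s q sab qI; have sT : 0 <= s <= T by lra.
  have [H1 H2 H3] := kd s q sT qI; split.
  + apply: (@has_der_sub _ _ `[0, T]); first by apply: itv_sub; lra.
    by have := has_derB H1 (has_der_cst `[0, T] (d * q) s); rewrite subr0.
  + have := has_derB H2 (has_derZ (c := d) (has_der_id `[0, 1] q)).
    by rewrite mulr1.
  + by have := has_derB H3 (has_der_cst `[0, 1] d q); rewrite subr0.
- by move=> q qI; rewrite subr_ge0 ka.
- move=> s sab; have [] := k01 s; first lra.
  by rewrite mulr0 mulr1 subr0 subr_ge0.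
(* At a negative interior minimum of [k - d r] the slope is [d] and [k_rr >= 0], so [k_t = F > 0],
   against [k_t <= 0]. *)
- move=> s q sab qI; rewrite mul0r subr_lt0 => kneg /eqP; rewrite subr_eq0 => /eqP krd krr0.
  rewrite ke; [|lra..]; rewrite krd leNgt => /negP; apply.
  have lbk : -1 <= k s q by apply: lb; lra.
  have dq : d * q < 1 by nra.
  have dq0 : 0 < d * q by rewrite mulr_gt0; lra.
  rewrite /Falg mulr_gt0//.
    rewrite powR_gt0// ltr_pwDl ?exprn_gt0//; first lra.
    by rewrite divr_ge0 ?sqr_ge0.
  apply: Aalg_gt0 => //; try lra.
    have [k0|k0] := leP 0 (k s q); first by apply: le_lt_trans (sin_lex k0) kneg.
    apply: le_lt_trans dq0; rewrite -oppr_ge0 -sinN.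
    apply: sin_ge0_pi; have := @pi_ge2 R; lra.
  rewrite cos_le1 andbT cos_ge0_pihalf//; have := @pihalf_ge1 R; lra.
Qed.

Lemma flow_barrier {R : realType} (p T d : R) (k kt kr krr : R -> R -> R) :
  1 < p < 2 -> 0 < d < 1 -> flow_data p T k kt kr krr ->
  (exists M, forall t r, 0 <= t <= T -> 0 <= r <= 1 -> `|kt t r| <= M) ->
  (forall t, 0 <= t <= T -> 0 <= k t 0 /\ d <= k t 1) ->
  (forall r, 0 <= r <= 1 -> d * r <= k 0 r) ->
  forall t r, 0 <= t <= T -> 0 <= r <= 1 -> d * r <= k t r.
Proof.
move=> p12 d01 kf [M ktM] k01 k0 t r /andP[t0 tT] rI.
(* Slab height for which [M eta <= 1], valid even when [M = 0]; induction on the number of slabs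
   then reaches any time up to [T]. *)
pose eta := (1 + `|M|)^-1.
have e0 : 0 < eta by rewrite invr_gt0 ltr_pwDl.
have Me : M * eta <= 1.
  rewrite ler_pdivrMr ?mul1r ?ltr_pwDl//.
  by apply: le_trans (ler_norm _) _; rewrite lerDr.
have key n : forall t r, 0 <= t <= T -> t <= n%:R * eta -> 0 <= r <= 1 -> d * r <= k t r.
  elim: n => [|n IH] s q sT sn qI.
    by have -> : s = 0 by [lra]; apply: k0.
  have [sn'|sn'] := leP s (n%:R * eta); first exact: IH.
  have n0 : 0 <= n%:R * eta by rewrite mulr_ge0// ltW.
  have M0 : 0 <= M by apply: le_trans (ktM s q sT qI).
  apply: (flow_barrier_step p12 d01 n0 sn' _ _ kf ktM k01) => //; try lra.
    apply: le_trans Me; rewrite ler_wpM2l//.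
    by move: sn; rewrite -natr1 mulrDl mul1r; lra.
  by move=> q' q'I; apply: IH => //; lra.
apply: (key (Num.truncn (t / eta)).+1) => //; first by rewrite t0.
by rewrite -ler_pdivrMr// ltW// truncnS_gt.
Qed.

(** * Behaviour at the origin *)

Lemma cvg_within_right0 {R : realType} (f : R -> R) (l : R) :
  f y @[y --> within `[0, 1] (0 : R)^'] --> l -> f y @[y --> (0 : R)^'+] --> l.
Proof.
move=> /cvgrPdist_le H; apply/cvgrPdist_le => e /H/within_dnbhsP[d d0 Hd].
near=> y; have y0 : 0 < y by near: y; exact: nbhs_right_gt.
apply: Hd.
- rewrite /= in_itv /= ltW//=; near: y; exact: nbhs_right_le.
- by rewrite gt_eqF.
- by rewrite subr0 gtr0_norm//; near: y; exact: nbhs_right_lt.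
Unshelve. all: by end_near. Qed.

(** The square has exponent [4 - p], which is below [3]. *)
Lemma powR_sqr_le {R : realType} (p J : R) : 1 < p < 2 -> 0 < J ->
  (J `^ (- ((p - 4) / 2))) ^+ 2 <= (1 + J) ^+ 3.
Proof.
move=> p12 J0; have J1 : 0 <= 1 + J by lra.
rewrite -!powR_mulrn ?powR_ge0// -powRrM.
apply: le_trans (_ : (1 + J) `^ (- ((p - 4) / 2) * 2) <= _).
  by apply: ge0_ler_powR; rewrite ?nnegrE; lra.
by apply: ler_powR; lra.
Qed.

(** In [r^4 A] every term but [- s^3 c] carries a factor [r]. On the other side
    [A = F J^((4 - p) / 2)] with [F] bounded and [J] of order at most [r^-2], so [r^4 A] itself is
    [O(r)]. *)
Lemma origin_estimate {R : realType} (p M N y b s c r : R) :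
  1 < p < 2 -> 0 < r <= 1 -> `|y| <= M -> `|b| <= M -> `|s| <= 1 -> `|c| <= 1 ->
  `|Falg p y b s c r| <= N ->
  `|s ^+ 3 * c| <= r * (2 * M ^+ 3 + 2 * M ^+ 2 + 3 * M + N * (M ^+ 2 + 2) ^+ 2).
Proof.
move=> p12 /andP[r0 r1] yM bM s1 c1 FN.
have M0 : 0 <= M by apply: le_trans yM.
have N0 : 0 <= N by apply: le_trans FN.
(* For [s = 0] the claim is trivial; otherwise [J > 0] and [A] can be recovered from [F]. *)
have [->|s0] := eqVneq s 0.
  rewrite expr0n /= mul0r normr0 mulr_ge0 ?(ltW r0)//.
  by rewrite !addr_ge0 ?mulr_ge0 ?exprn_ge0 ?addr_ge0 ?sqr_ge0.
set J := y ^+ 2 + s ^+ 2 / r ^+ 2.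
have r2 : 0 < r ^+ 2 by rewrite exprn_gt0.
have J0 : 0 < J.
  by rewrite ltr_wpDl ?sqr_ge0// divr_gt0// lt_neqAle sqr_ge0 eq_sym sqrf_eq0 s0.
set A := Aalg p y b s c r.
have A2 : A ^+ 2 <= N ^+ 2 * (1 + J) ^+ 3.
  have -> : A = Falg p y b s c r * J `^ (- ((p - 4) / 2)).
    by rewrite /Falg powRN mulrAC mulfV ?mul1r// gt_eqF// powR_gt0.
  rewrite exprMn ler_pM ?sqr_ge0//; last exact: powR_sqr_le.
  by rewrite -[Falg _ _ _ _ _ _ ^+ 2]real_normK ?num_real// ler_pXn2r ?nnegrE.
have le1 (k x B : R) : 0 <= k <= 1 -> `|x| <= B -> `|k * x| <= B.
  move=> /andP[k0 k1] xB; rewrite normrM (ger0_norm k0).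
  by apply: le_trans xB; rewrite ler_piMl.
have y2 : y ^+ 2 <= M ^+ 2.
  by rewrite -[y ^+ 2]real_normK ?num_real// ler_pXn2r ?nnegrE.
have s2 : s ^+ 2 <= 1.
  by rewrite -[s ^+ 2]real_normK ?num_real// expr_le1.
have rJ : r ^+ 2 * (1 + J) <= M ^+ 2 + 2.
  have -> : r ^+ 2 * (1 + J) = r ^+ 2 * (1 + y ^+ 2) + s ^+ 2.
    by rewrite /J; field; rewrite gt_eqF.
  have : r ^+ 2 * (1 + y ^+ 2) <= 1 + y ^+ 2.
    by rewrite ler_piMl ?addr_ge0 ?sqr_ge0// expr_le1// ltW.
  lra.
have E : `|r ^+ 4 * A| <= r * (N * (M ^+ 2 + 2) ^+ 2).
  have B2 : 1 <= M ^+ 2 + 2 by have := sqr_ge0 M; lra.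
  rewrite -(@ler_pXn2r _ 2) ?nnegrE ?mulr_ge0 ?exprn_ge0 ?(ltW r0) ?(le_trans ler01 B2)//.
  rewrite real_normK ?num_real// exprMn.
  apply: le_trans (_ : (r ^+ 4) ^+ 2 * (N ^+ 2 * (1 + J) ^+ 3) <= _).
    by rewrite ler_pM2l// !exprn_gt0.
  have -> : (r ^+ 4) ^+ 2 * (N ^+ 2 * (1 + J) ^+ 3) =
     r ^+ 2 * N ^+ 2 * (r ^+ 2 * (1 + J)) ^+ 3 by ring.
  rewrite [leRHS]exprMn [X in _ <= _ * X]exprMn [leRHS]mulrA ler_wpM2l ?(mulr_ge0 (sqr_ge0 _) (sqr_ge0 _))//.
  apply: le_trans (_ : (M ^+ 2 + 2) ^+ 3 <= _).
    have rJ0 : 0 <= r ^+ 2 * (1 + J) by apply: mulr_ge0; lra.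
    by rewrite ler_pXn2r ?nnegrE ?(le_trans rJ0 rJ).
  by rewrite -exprM ler_weXn2l.
have M2e (x z B D : R) : `|x| <= B -> `|z| <= D -> `|x * z| <= B * D.
  by move=> xB zD; rewrite normrM ler_pM.
have t1 : `|(p - 1) * (y * y * b)| <= M * M * M.
  by apply: le1; [lra|rewrite !M2e].
have t2 : `|y * y * (s * c)| <= M * M * (1 * 1) by rewrite !M2e.
have t3 : `|y * (s * s)| <= M * (1 * 1) by rewrite !M2e.
have t4 : `|y * y * y| <= M * M * M by rewrite !M2e.
have t5 : `|b * (s * s)| <= M * (1 * 1) by rewrite !M2e.
have r01 n : 0 <= r ^+ n <= 1 by rewrite exprn_ge0 ?exprn_ile1 ?(ltW r0).
have := le1 _ _ _ (r01 3) t1; have := le1 _ _ _ (r01 1) t2.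
have := le1 _ _ _ (r01 2) t4; have := le1 _ _ _ (r01 1) t5; rewrite !expr1.
move=> u5 u4 u2 u1.
have u3 : `|(p - 3) * (r * (y * y * (s * c)) - y * (s * s))| <=
    2 * (M * M * (1 * 1) + M * (1 * 1)).
  apply: M2e; first by rewrite ler_norml; lra.
  apply: le_trans (ler_normB _ _) _. exact: lerD.
have -> : s ^+ 3 * c = r * (r ^+ 3 * ((p - 1) * (y * y * b))
   + (p - 3) * (r * (y * y * (s * c)) - y * (s * s))
   + r ^+ 2 * (y * y * y) + r * (b * (s * s))) - r ^+ 4 * A.
  by rewrite /A /Aalg; field; rewrite gt_eqF.
apply: le_trans (ler_normB _ _) _; rewrite [leRHS]mulrDr; apply: lerD => //.
rewrite normrM gtr0_norm// ler_pM2l//.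
apply: le_trans (ler_normD _ _) _.
have := ler_normD (r ^+ 3 * ((p - 1) * (y * y * b))
   + (p - 3) * (r * (y * y * (s * c)) - y * (s * s))) (r ^+ 2 * (y * y * y)).
have := ler_normD (r ^+ 3 * ((p - 1) * (y * y * b)))
   ((p - 3) * (r * (y * y * (s * c)) - y * (s * s))).
lra.
Qed.

(** A finite limit of [F] keeps it bounded near [0], so the previous estimate sends [sin^3 g cos g]
    to [0], and [g] is continuous at [0]. *)
Lemma origin_value {R : realType} (p M L : R) (g gr grr : R -> R) :
  1 < p < 2 -> has_der `[0, 1] g 0 (gr 0) ->
  (forall r, 0 <= r <= 1 -> `|gr r| <= M /\ `|grr r| <= M) ->
  Falg p (gr r) (grr r) (sin (g r)) (cos (g r)) r @[r --> 0^'+] --> L ->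
  sin (g 0) ^+ 3 * cos (g 0) = 0.
Proof.
move=> p12 g0 gM FL.
have gc : g r @[r --> 0^'+] --> g 0 by apply: cvg_within_right0; exact: has_der_cvg g0.
have M0 : 0 <= M by apply: le_trans (gM 0 _).1; rewrite ?lexx ?ler01.
pose f x : R := sin x ^+ 3 * cos x.
have fc : f (g r) @[r --> 0^'+] --> f (g 0).
  have sc : sin (g r) @[r --> 0^'+] --> sin (g 0).
    by apply: continuous_cvg gc; exact: continuous_sin.
  have cc : cos (g r) @[r --> 0^'+] --> cos (g 0).
    by apply: continuous_cvg gc; exact: continuous_cos.
  apply: (cvgM _ cc); apply: (cvgM sc); exact: (cvgM sc sc).
pose C := 2 * M ^+ 3 + 2 * M ^+ 2 + 3 * M + (`|L| + 1) * (M ^+ 2 + 2) ^+ 2.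
suff : f (g r) @[r --> 0^'+] --> (0 : R).
  by move=> /(cvg_unique (@norm_hausdorff _ _) fc).
apply/norm_cvg0P; apply: (@squeeze_cvgr _ _ _ _ (fun=> 0) (fun r => r * C)).
- near=> r.
  have r0 : 0 < r by near: r; exact: nbhs_right_gt.
  have r1 : r <= 1 by near: r; exact: nbhs_right_le.
  rewrite normr_ge0 /=.
  have [|yM bM] := gM r; first by rewrite ltW.
  have : `|L - Falg p (gr r) (grr r) (sin (g r)) (cos (g r)) r| <= 1.
    by near: r; move/cvgrPdist_le : FL; exact.
  move=> FL1.
  apply: (@origin_estimate _ p _ _ (gr r) (grr r)) => //; first by rewrite r0.
  + by rewrite ler_norml sin_geN1 sin_le1.
  + by rewrite ler_norml cos_geN1 cos_le1.
  + rewrite -[Falg _ _ _ _ _ _](subrK L).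
    by apply: le_trans (ler_normD _ _) _; rewrite addrC lerD// distrC.
- exact: cvg_cst.
- rewrite -[X in _ --> X](mul0r C); apply: cvgMl.
  exact: cvg_at_right_filter.
Unshelve. all: by end_near. Qed.

(** If [w] left [0], it would take by the intermediate value theorem some value [v] with
    [0 < |v| <= 1 < pi / 2], where sine and cosine do not vanish. *)
Lemma curve_eq0 {R : realType} (T : R) (w : R -> R) :
  {within `[0, T], continuous w} -> w 0 = 0 ->
  (forall t, 0 <= t <= T -> sin (w t) ^+ 3 * cos (w t) = 0) ->
  forall t, 0 <= t <= T -> w t = 0.
Proof.
move=> wc w0 wsc t /andP[t0 tT]; apply/eqP; apply/negPn/negP => wt0.
have sc (x : R) : 0 < x <= 1 -> 0 < sin x /\ 0 < cos x.
  move=> x01; have := @pihalf_ge1 R; have := @cos1_gt0 R => c1 p1; split.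
    by apply: sin_gt0_pi; have := @pi_ge2 R; lra.
  by apply: lt_le_trans c1 (cos_ge_cos1 _); lra.
have wct : {within `[0, t], continuous w}.
  by apply: continuous_subspaceW wc; exact: itv_sub.
have [v [v0 v1]] : exists v : R, (0 < v <= 1 \/ 0 < - v <= 1) /\
    Num.min (w 0) (w t) <= v <= Num.max (w 0) (w t).
  rewrite w0; have [wt|wt] := ltP 0 (w t).
    exists (Num.min (w t) 1); have [w1|w1] := leP (w t) 1; lra.
  exists (Num.max (w t) (- 1)); move: wt0 wt; rewrite le_eqVlt => /negPf ->/=.
  by move=> wt; have [w1|w1] := leP (w t) (-1); lra.
have [s] := IVT t0 wct v1; rewrite in_itv /= => st ws.
have sT : 0 <= s <= T by lra.
have H := wsc s sT; rewrite ws in H.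
case: v0 => /sc[sv cv]; have := mulr_gt0 (exprn_gt0 3 sv) cv.
  by rewrite H ltxx.
rewrite sinN cosN (_ : (- sin v) ^+ 3 * cos v = - (sin v ^+ 3 * cos v)); last by ring.
by rewrite H oppr0 ltxx.
Qed.

Lemma cos_ge1Bsqr {R : realType} (x : R) : 0 <= x -> 1 - cos x <= x ^+ 2.
Proof.
rewrite le_eqVlt => /predU1P[<-|x0]; first by rewrite cos0 subrr expr0n.
have [c /andP[c0 cx]] := @is_derive_MVT R 0 x cos (fun z => - sin z) x0 (fun z _ => is_derive_cos z).
rewrite cos0 subr0 => E; rewrite -(opprB (cos x)) E mulNr opprK expr2.
rewrite ler_pM2r//; have := sin_lex (ltW c0); lra.
Qed.

Lemma sin_geBcube {R : realType} (x : R) : 0 <= x -> x - sin x <= x ^+ 3.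
Proof.
rewrite le_eqVlt => /predU1P[<-|x0]; first by rewrite sin0 subrr expr0n.
have [c /andP[c0 cx]] := @is_derive_MVT R 0 x sin cos x0 (fun z _ => is_derive_sin z).
rewrite sin0 !subr0 => ->; rewrite -{1}[x]mul1r -mulrBl exprSr ler_pM2r//.
apply: le_trans (cos_ge1Bsqr (ltW c0)) _.
rewrite ler_pXn2r ?nnegrE//; lra.
Qed.

(** The mean value theorem applied to [g - g'(0) x - b x^2 / 2] reduces the second order expansion
    to the first order one of [gr] at [0]. *)
Lemma has_der_taylor2 {R : realType} (g gr : R -> R) (b : R) :
  (forall r, 0 <= r <= 1 -> has_der `[0, 1] g r (gr r)) ->
  has_der `[0, 1] gr 0 b ->
  (g r - g 0 - gr 0 * r) / r ^+ 2 @[r --> 0^'+] --> b / 2.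
Proof.
move=> gd /has_derP grd; apply/cvgrPdist_le => e e0.
have [d d0 Hd] := grd e e0; near=> r.
have r0 : 0 < r by near: r; exact: nbhs_right_gt.
have r1 : r <= 1 by near: r; exact: nbhs_right_le.
have rd : r < d by near: r; exact: nbhs_right_lt.
have [x xr|c /andP[c0 cr]] := @has_der_MVT _ 0 r
  (fun x => g x - gr 0 * x - b / 2 * (x * x)) (fun x => gr x - gr 0 - b * x) r0.
  apply: (@has_der_sub _ _ `[0, 1]); first exact: itv_sub.
  have xI : 0 <= x <= 1 by lra.
  have H1 := has_derZ (c := gr 0) (has_der_id `[0, 1] x).
  have H2 := has_derZ (c := b / 2) (has_derM (has_der_id `[0, 1] x) (has_der_id `[0, 1] x)).
  have := has_derB (has_derB (gd x xI) H1) H2.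
  by congr (has_der _ _ _ _); field.
rewrite !subr0 !mulr0 !subr0 => E.
have := Hd c; rewrite !subr0 (gtr0_norm c0) /= in_itv /= => Hc.
have {}Hc : `|gr c - gr 0 - b * c| <= e * r.
  apply: (le_trans (Hc _ _)); [lra|lra|].
  by rewrite ler_pM2l// ltW.
have -> : b / 2 - (g r - g 0 - gr 0 * r) / r ^+ 2 = - ((gr c - gr 0 - b * c) / r).
  have -> : gr c - gr 0 - b * c = (g r - gr 0 * r - b / 2 * (r * r) - g 0) / r.
    by rewrite E mulfK// gt_eqF.
  by field; rewrite gt_eqF.
rewrite normrN normrM (gtr0_norm (_ : 0 < r^-1)) ?invr_gt0//.
by rewrite ler_pdivrMr.
Unshelve. all: by end_near. Qed.

Lemma eq_cvg_right0 {R : realType} (f g : R -> R) (l : R) :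
  (forall r, 0 < r -> f r = g r) ->
  g r @[r --> (0 : R)^'+] --> l -> f r @[r --> (0 : R)^'+] --> l.
Proof.
move=> fg gl; apply: (cvg_trans _ gl); apply: near_eq_cvg; near=> r.
by rewrite fg//; near: r; exact: nbhs_right_gt.
Unshelve. all: by end_near. Qed.

Lemma cvg_id_right0 {R : realType} : r @[r --> (0 : R)^'+] --> (0 : R).
Proof. exact: cvg_at_right_filter. Qed.

(* With [k = sin g / r], Taylor expansion at [0] gives [(g' - k) / r --> g''(0) / 2],
   and [F --> (2 g'(0)^2)^((p-4)/2) * (3p/2) g'(0)^2 g''(0)]. *)
Lemma drr_origin {R : realType} (p : R) (g gr grr : R -> R) :
  1 < p < 2 -> (forall r, 0 <= r <= 1 -> has_der `[0, 1] g r (gr r)) ->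
  has_der `[0, 1] gr 0 (grr 0) -> grr r @[r --> 0^'+] --> grr 0 ->
  g 0 = 0 -> 0 < gr 0 ->
  Falg p (gr r) (grr r) (sin (g r)) (cos (g r)) r @[r --> 0^'+] --> (0 : R) ->
  grr 0 = 0.
Proof.
move=> p12 gd grd Hb g0 a0 HF.
have Ht := has_der_taylor2 gd grd; rewrite g0 in Ht.
have g0d : has_der `[0, 1] g 0 (gr 0) by apply: gd; rewrite lexx ler01.
set b0 := grr 0 in grd Hb Ht *; set a := gr 0 in a0 g0d Ht *.
have Hy : gr r @[r --> 0^'+] --> a by apply: cvg_within_right0; exact: has_der_cvg grd.
have Hyr : (gr r - a) / r @[r --> 0^'+] --> b0.
  by apply: eq_cvg_right0 (cvg_within_right0 grd) => r _; rewrite subr0.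
have Hgr : g r / r @[r --> 0^'+] --> a.
  by apply: eq_cvg_right0 (cvg_within_right0 g0d) => r _; rewrite g0 !subr0.
have Hi := @cvg_id_right0 R.
have g_gt0 : \forall r \near (0 : R)^'+, 0 <= g r.
  have /cvgrPdist_lt/(_ _ a0) H := Hgr; near=> r.
  have r0 : 0 < r by near: r; exact: nbhs_right_gt.
  have : `|a - g r / r| < a by near: r.
  move=> /ltr_normlW; rewrite ltrBlDr -ltrBlDl subrr => gr0.
  by rewrite ltW// -(divfK (lt0r_neq0 r0) (g r)) mulr_gt0.
have Hs : (g r - sin (g r)) / r ^+ 2 @[r --> 0^'+] --> (0 : R).
  apply: (@squeeze_cvgr _ _ _ _ (fun=> 0) (fun r => g r / r * (g r / r) * (g r / r) * r)).
  - near=> r; have r0 : 0 < r by near: r; exact: nbhs_right_gt.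
    have gr0 : 0 <= g r by near: r.
    rewrite divr_ge0 ?subr_ge0 ?sin_lex ?sqr_ge0//=.
    rewrite ler_pdivrMr ?exprn_gt0//; apply: le_trans (sin_geBcube gr0) _.
    by rewrite le_eqVlt; apply/orP; left; apply/eqP; field; rewrite gt_eqF.
  - exact: cvg_cst.
  - rewrite -[X in _ --> X](mulr0 (a * a * a)).
    by apply: (cvgM _ Hi); apply: (cvgM _ Hgr); exact: (cvgM Hgr Hgr).
have Hc : (1 - cos (g r)) / r @[r --> 0^'+] --> (0 : R).
  apply: (@squeeze_cvgr _ _ _ _ (fun=> 0) (fun r => g r / r * (g r / r) * r)).
  - near=> r; have r0 : 0 < r by near: r; exact: nbhs_right_gt.
    have gr0 : 0 <= g r by near: r.
    rewrite divr_ge0 ?subr_ge0 ?cos_le1 ?(ltW r0)//=.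
    rewrite ler_pdivrMr//; apply: le_trans (cos_ge1Bsqr gr0) _.
    by rewrite le_eqVlt; apply/orP; left; apply/eqP; field; rewrite gt_eqF.
  - exact: cvg_cst.
  - rewrite -[X in _ --> X](mulr0 (a * a)).
    by apply: (cvgM _ Hi); exact: (cvgM Hgr Hgr).
have Hk : sin (g r) / r @[r --> 0^'+] --> a.
  apply: (@eq_cvg_right0 _ _ (fun r => g r / r - (g r - sin (g r)) / r ^+ 2 * r)).
    by move=> r r0; field; rewrite gt_eqF.
  rewrite -[X in _ --> X](subr0 a) -[X in _ - X](mulr0 0).
  by apply: cvgB => //; exact: cvgM.
have Hyk : (gr r - sin (g r) / r) / r @[r --> 0^'+] --> b0 / 2.
  apply: (@eq_cvg_right0 _ _ (fun r => (gr r - a) / r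
      - (g r - 0 - a * r) / r ^+ 2 + (g r - sin (g r)) / r ^+ 2)).
    by move=> r r0; field; rewrite gt_eqF.
  rewrite (_ : b0 / 2 = b0 - b0 / 2 + 0); last by field.
  by apply: cvgD => //; exact: cvgB.
have HA : Aalg p (gr r) (grr r) (sin (g r)) (cos (g r)) r @[r --> 0^'+] -->
    3 * p / 2 * a ^+ 2 * b0.
  (* The [1 / r] terms pair up: [y^2 k c - y k^2] over [r] is [y k (d - y e)], and [y^3 - k^3 c]
     over [r] is [d (y^2 + y k + k^2) + k^3 e], where [y = gr r] and [c = cos (g r)]. Every
     ingredient then has a limit. *)
  pose k r := sin (g r) / r; pose d r := (gr r - sin (g r) / r) / r.
  pose e r := (1 - cos (g r)) / r.
  have -> : 3 * p / 2 * a ^+ 2 * b0 = (p - 1) * (a * a * b0)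
     + (p - 3) * (a * a * (b0 / 2 - a * 0))
     + (b0 / 2 * (a * a + a * a + a * a) + a * a * a * 0) + b0 * (a * a).
    by field.
  apply: (@eq_cvg_right0 _ _ (fun r => (p - 1) * (gr r * gr r * grr r)
     + (p - 3) * (gr r * k r * (d r - gr r * e r))
     + (d r * (gr r * gr r + gr r * k r + k r * k r) + k r * k r * k r * e r)
     + grr r * (k r * k r))).
    by move=> r r0; rewrite /Aalg /d /e /k; field; rewrite gt_eqF.
  have Ck : k r @[r --> 0^'+] --> a by [].
  have Cd : d r @[r --> 0^'+] --> b0 / 2 by [].
  have Ce : e r @[r --> 0^'+] --> (0 : R) by [].
  clearbody k d e.
  apply: cvgD; last by apply: (cvgM Hb); exact: (cvgM Ck Ck).
  apply: cvgD.
    apply: cvgD; (apply: cvgM; first exact: cvg_cst).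
      by apply: (cvgM _ Hb); exact: (cvgM Hy Hy).
    by apply: (cvgM (cvgM Hy Ck)); apply: (cvgB Cd); exact: (cvgM Hy Ce).
  apply: cvgD; last by apply: (cvgM _ Ce); apply: (cvgM _ Ck); exact: (cvgM Ck Ck).
  apply: (cvgM Cd); apply: cvgD; last exact: (cvgM Ck Ck).
  by apply: cvgD; [exact: (cvgM Hy Hy)|exact: (cvgM Hy Ck)].
have HJ : gr r ^+ 2 + sin (g r) ^+ 2 / r ^+ 2 @[r --> 0^'+] --> a * a + a * a.
  apply: (@eq_cvg_right0 _ _ (fun r => gr r * gr r
      + sin (g r) / r * (sin (g r) / r))).
    by move=> r r0; field; rewrite gt_eqF.
  by apply: cvgD; exact: cvgM.
have aa : 0 < a * a + a * a by rewrite addr_gt0// mulr_gt0.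
have HJq : (gr r ^+ 2 + sin (g r) ^+ 2 / r ^+ 2) `^ ((p - 4) / 2) @[r --> 0^'+] -->
    (a * a + a * a) `^ ((p - 4) / 2).
  apply: (@continuous_cvg _ _ _ _ _ _ (fun z : R => z `^ ((p - 4) / 2)) _ _ HJ).
  have [D _] := is_derive1_powR ((p - 4) / 2) aa.
  by apply: differentiable_continuous; exact/derivable1_diffP.
have : (a * a + a * a) `^ ((p - 4) / 2) * (3 * p / 2 * a ^+ 2 * b0) = 0.
  by apply: (cvg_unique (@norm_hausdorff R R) _ HF); exact: (cvgM HJq HA).
have P : 0 < (a * a + a * a) `^ ((p - 4) / 2) * (3 * p / 2 * a ^+ 2).
  by rewrite mulr_gt0 ?powR_gt0 ?mulr_gt0 ?exprn_gt0 ?invr_gt0//; lra.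
by rewrite mulrA => /eqP; rewrite mulf_eq0 (gt_eqF P) /= => /eqP.
Unshelve. all: by end_near. Qed.

(** * Properties of a classical solution *)

Lemma derivable_in_has_der {R : realType} (D : set R) (f : R -> R) (x : R) :
  derivable_in D f x -> has_der D f x (derive_in D f x).
Proof. by []. Qed.

Lemma classical_flow_data {R : realType} (p : R) (h0 : R -> R) (T : R)
    (h : R -> R -> R) : classical_solution p h0 T h ->
  flow_data p T h (dt T h) (fun t => dr (h t)) (fun t => drr (h t)).
Proof.
move=> [[hd hc _ _ _] he _ _ _]; split=> // t r tT rI.
have [|? ? ?] := hd t r; last by split; exact: derivable_in_has_der.
by split; rewrite /I01 /= in_itv.
Qed.

Lemma within_rect_cvg_right0 {R : realType} (T t : R) (f : R * R -> R) :
  0 <= t <= T -> {within rect T, continuous f} ->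
  f (t, r) @[r --> (0 : R)^'+] --> f (t, 0).
Proof.
move=> tT /subspace_continuousP/(_ (t, 0)) H.
have {}H : f x @[x --> within (rect T) (nbhs (t, 0))] --> f (t, 0).
  by apply: H; split; rewrite /I01 /= in_itv /= ?lexx ?ler01.
apply: cvg_comp H => P; rewrite /within /= => HP.
have C : (t, r) @[r --> (0 : R)^'+] --> (t, (0 : R)).
  apply: (@cvg_pair _ _ _ _ (nbhs t) (nbhs (0 : R))); first exact: cvg_cst.
  exact: cvg_id_right0.
have := C _ HP; rewrite /nbhs /= => N; near=> r.
have : rect T (t, r) -> P (t, r) by near: r.
apply; split; rewrite /I01 /= in_itv //=; apply/andP; split; near: r.
  exact: nbhs_right_ge.
exact: nbhs_right_le.
Unshelve. all: by end_near. Qed.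

Section ClassicalSolution.
Variables (R : realType) (p : R) (h0 : R -> R) (d : R).
Hypotheses (p12 : 1 < p < 2) (h0_der : derivable_in (@I01 R) h0 0) (h0_0 : h0 0 = 0).
Hypotheses (d01 : 0 < d < 1)
  (h0_barrier : forall r, 0 <= r <= 1 -> d * r <= h0 r <= pi - d * r).
Variables (T : R) (h : R -> R -> R).
Hypotheses (T0 : 0 < T) (hsol : classical_solution p h0 T h).

Let hflow := classical_flow_data hsol.

(** The initial condition is imposed on the open interval only; [r = 1] follows from the boundary
    condition and [r = 0] by continuity of both profiles. *)
Lemma classical_init (r : R) : 0 <= r <= 1 -> h 0 r = h0 r.
Proof.
move=> /andP[r0 r1]; have [_ _ _ hi hb] := hsol; have [_ hd _] := hflow.
have [->|rn1] := eqVneq r 1; first by apply: hb; rewrite lexx ltW.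
have [->|rn0] := eqVneq r 0; last first.
  by apply: hi; rewrite lt_neqAle eq_sym rn0 r0 lt_neqAle rn1.
have [||_ H _] := hd 0 0; rewrite ?lexx ?ler01 ?(ltW T0)//.
have C := cvg_within_right0 (has_der_cvg H).
have C0 := cvg_within_right0 (has_der_cvg (derivable_in_has_der h0_der)).
apply: (cvg_unique (@norm_hausdorff R R) C).
apply: cvg_trans C0; apply: near_eq_cvg; near=> x.
symmetry; apply: hi; apply/andP; split; near: x.
  exact: nbhs_right_gt.
exact: nbhs_right_lt.
Unshelve. all: by end_near. Qed.

Lemma classical_bounded : exists M : R, forall t r, 0 <= t <= T -> 0 <= r <= 1 ->
  [/\ `|dt T h t r| <= M, `|dr (h t) r| <= M & `|drr (h t) r| <= M].
Proof.
have [[_ _ c1 c2 c3] _ _ _ _] := hsol.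
have [M1 H1] := rect_bounded (ltW T0) c1.
have [M2 H2] := rect_bounded (ltW T0) c2.
have [M3 H3] := rect_bounded (ltW T0) c3.
exists (`|M1| + `|M2| + `|M3|) => t r tT rI.
have := H1 _ _ tT rI; have := H2 _ _ tT rI; have := H3 _ _ tT rI => /=.
have := ler_norm M1; have := ler_norm M2; have := ler_norm M3.
have := normr_ge0 M1; have := normr_ge0 M2; have := normr_ge0 M3.
by move=> *; split; lra.
Qed.

(** The finite limit of [F] at [r = 0] acts as a hidden boundary condition: it confines [h t 0] to
    the zeros of [sin^3 cos], among which [0] is isolated. *)
Lemma classical_origin (t : R) : 0 <= t <= T -> h t 0 = 0.
Proof.
have [_ _ hl _ _] := hsol; have [_ hd _] := hflow.
have I0 : 0 <= (0 : R) <= 1 by rewrite lexx ler01.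
have [M HM] := classical_bounded.
apply: (@curve_eq0 _ T (h^~ 0)).
- by apply: has_der_within_continuous => s sT; have [H _ _] := hd _ _ sT I0; exact: H.
- by rewrite classical_init ?lexx ?ler01.
- move=> s sT; have [_ H _] := hd _ _ sT I0.
  apply: (origin_value p12 H _ (hl s sT)) => r rI.
  by have [_ A B] := HM s r sT rI; split; [exact: A|exact: B].
Qed.

Lemma classical_barrier (t r : R) : 0 <= t <= T -> 0 <= r <= 1 ->
  d * r <= h t r <= pi - d * r.
Proof.
move=> tT rI; have [M HM] := classical_bounded; have [_ _ _ _ hb] := hsol.
have h1 : d <= h0 1 <= pi - d.
  by have := h0_barrier; move=> /(_ 1); rewrite lexx ler01 mulr1; apply.
have hi q : 0 <= q <= 1 -> d * q <= h 0 q <= pi - d * q.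
  by move=> qI; rewrite classical_init// h0_barrier.
have L : d * r <= h t r.
  apply: (flow_barrier p12 d01 hflow) => //.
  - by exists M => s q sT qI; have [] := HM s q sT qI.
  - by move=> s sT; rewrite classical_origin// hb//; split=> //; lra.
  - by move=> q /hi; lra.
have U : d * r <= pi - h t r.
  apply: (flow_barrier p12 d01 (flow_data_refl hflow) _ _ _ tT rI) => //.
  - by exists M => s q sT qI; rewrite normrN; have [] := HM s q sT qI.
  - by move=> s sT; rewrite classical_origin// hb//; have := @pi_ge0 R; split; lra.
  - by move=> q /hi; lra.
lra.
Qed.

Lemma classical_le_linear (t r M : R) : 0 <= t <= T ->
  (forall q, 0 <= q <= 1 -> `|dr (h t) q| <= M) -> 0 < r <= 1 -> h t r <= M * r.
Proof.
move=> tT HM /andP[r0 r1]; have [_ hd _] := hflow.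
have [q qr|c /andP[c0 cr]] := @has_der_MVT _ 0 r (h t) (dr (h t)) r0.
  have qI : 0 <= q <= 1.
    by case/andP: qr => -> qr; exact: le_trans r1.
  have [_ H _] := hd _ _ tT qI.
  by apply: has_der_sub H; exact: itv_sub.
rewrite classical_origin// !subr0 => ->; rewrite ler_pM2r//.
by apply: le_trans (ler_norm _) (HM _ _); rewrite ltW//= (le_trans (ltW cr)).
Qed.

(** [h t r - d r] is nonnegative and vanishes at [r = 0]. *)
Lemma classical_slope (t : R) : 0 <= t <= T -> d <= dr (h t) 0.
Proof.
move=> tT; have [_ hd _] := hflow; have I0 : 0 <= (0 : R) <= 1 by rewrite lexx ler01.
have [_ H _] := hd _ _ tT I0.
have H2 := has_derB H (has_derZ (c := d) (has_der_id `[0, 1] 0)).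
have := has_der_ge0_right (_ : 0 <= 0 < 1) H2; rewrite lexx ltr01 mulr1 subr_ge0.
apply=> // y yI; rewrite classical_origin// mulr0 subr0 subr_ge0.
by have := @classical_barrier t y tT; lra.
Qed.

Lemma classical_dt_eq0 (t r c : R) : 0 <= t <= T -> 0 <= r <= 1 ->
  (forall s, 0 <= s <= T -> h s r = c) -> dt T h t r = 0.
Proof.
move=> tT rI hc; have [_ hd _] := hflow; have [H _ _] := hd _ _ tT rI.
apply: (has_der_uniq T0 tT H); apply: eq_has_der (has_der_cst _ c t).
  by rewrite /= in_itv.
by move=> s; rewrite /= in_itv /= => /hc.
Qed.

Lemma classical_drr (t : R) : 0 <= t <= T -> drr (h t) 0 = 0.
Proof.
move=> tT; have [[_ _ _ _ hc] _ hl _ _] := hsol; have [_ hd _] := hflow.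
have I0 : 0 <= (0 : R) <= 1 by rewrite lexx ler01.
have Hd r : 0 <= r <= 1 -> has_der `[0, 1] (h t) r (dr (h t) r).
  by move=> rI; have [] := hd _ _ tT rI.
have [_ _ Hdd] := hd _ _ tT I0.
apply: (drr_origin p12 Hd Hdd).
- exact: (within_rect_cvg_right0 tT hc).
- exact: classical_origin.
- by apply: lt_le_trans (classical_slope tT); case/andP: d01.
(* [h] vanishes along [r = 0], so the limit of [F] there, being [h_t], is [0]. *)
- have := hl t tT; rewrite (@classical_dt_eq0 t 0 0)//.
  by move=> s sT; exact: classical_origin.
Qed.

Lemma classical_Fop1 (t : R) : 0 <= t <= T -> Fop p (h t) 1 = 0.
Proof.
move=> tT; have [_ he _ _ hb] := hsol; rewrite -he ?ltr01 ?lexx//.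
by apply: (@classical_dt_eq0 t 1 (h0 1)); rewrite ?lexx ?ler01.
Qed.

End ClassicalSolution.

(** * Comparison of two solutions and the conclusion *)

(** The barriers put [x] between [d q] and [pi - d q], so [sin x >= sin (d q)], and [d q <= 1]
    allows the linear lower bound with slope [cos 1]. *)
Lemma sin_between {R : realType} (d q M h1 h2 x : R) :
  0 < d < 1 -> 0 < q <= 1 -> d * q <= h2 -> h1 <= pi - d * q -> h1 <= M * q ->
  h2 <= x <= h1 -> cos 1 * d * q <= sin x <= M * q.
Proof.
move=> d01 /andP[q0 q1] h2q h1q h1M /andP[h2x xh1].
have dq : 0 < d * q by rewrite mulr_gt0//; lra.
have dq1 : d * q <= 1 by rewrite mulr_ile1//; lra.
apply/andP; split.
  rewrite -mulrA; apply: le_trans (sin_ge_cos1M _) _; first lra.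
  by apply: le_sin_itv; lra.
by apply: le_trans (sin_lex _) _; lra.
Qed.

Lemma classical_le {R : realType} (p d T : R) (h0 : R -> R) (h1 h2 : R -> R -> R) :
  1 < p < 2 -> derivable_in (@I01 R) h0 0 -> h0 0 = 0 -> 0 < d < 1 ->
  (forall r, 0 <= r <= 1 -> d * r <= h0 r <= pi - d * r) -> 0 < T ->
  classical_solution p h0 T h1 -> classical_solution p h0 T h2 ->
  forall t r, 0 <= t <= T -> 0 <= r <= 1 -> h1 t r <= h2 t r.
Proof.
move=> p12 h0d h00 d01 h0b T0 s1 s2 t r tT rI.
have [hc1 hd1 he1] := classical_flow_data s1.
have [hc2 hd2 he2] := classical_flow_data s2.
have [M1 HM1] := classical_bounded T0 s1; have [M2 HM2] := classical_bounded T0 s2.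
have b1 := classical_barrier p12 h0d h00 d01 h0b T0 s1.
have b2 := classical_barrier p12 h0d h00 d01 h0b T0 s2.
have [_ _ _ _ hb1] := s1; have [_ _ _ _ hb2] := s2.
pose m := cos 1 * d; have c1 := @cos1_gt0 R.
have m0 : 0 < m by rewrite mulr_gt0//; lra.
pose M := `|M1| + `|M2| + m.
have M1M : M1 <= M by have := ler_norm M1; have := normr_ge0 M2; rewrite /M; lra.
have M2M : M2 <= M by have := ler_norm M2; have := normr_ge0 M1; rewrite /M; lra.
have mM : m <= M by have := normr_ge0 M1; have := normr_ge0 M2; rewrite /M; lra.
have [K HK] := Falg_diff_le p12 m0 mM.
rewrite -subr_ge0.
(* The extra [1] gives strictness: where [u = h2 - h1 < 0], the Lipschitz bound yields
   [u_t >= K u > (K + 1) u]. *)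
apply: (@weak_min_principle _ (K + 1) 0 T (fun t r => h2 t r - h1 t r)
  (fun t r => dt T h2 t r - dt T h1 t r) (fun t r => dr (h2 t) r - dr (h1 t) r)
  (fun t r => drr (h2 t) r - drr (h1 t) r)) => //.
- exact: within_continuousB hc2 hc1.
- move=> s q sT qI; have [A1 B1 C1] := hd1 s q sT qI.
  have [A2 B2 C2] := hd2 s q sT qI.
  split; [exact: (has_derB A2 A1)|exact: (has_derB B2 B1)|exact: (has_derB C2 C1)].
- move=> q qI; rewrite (classical_init h0d T0 s1)// (classical_init h0d T0 s2)//.
  by rewrite subrr.
- move=> s sT; rewrite hb1// hb2// !(classical_origin p12 h0d h00 T0 _ sT)//.
  by rewrite !subrr.
move=> s q sT qI; rewrite subr_lt0 => h21 /eqP; rewrite subr_eq0 => /eqP y12.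
rewrite subr_ge0 => b12; have sT' : 0 <= s <= T by case/andP: sT => /ltW -> ->.
have qI1 : 0 < q <= 1 by case/andP: qI => -> /ltW ->.
have qI' : 0 <= q <= 1 by case/andP: qI => /ltW -> /ltW ->.
have [_ y1M _] := HM1 s q sT' qI'; have [t2M _ b2M] := HM2 s q sT' qI'.
rewrite he1// he2// y12; apply/negP; rewrite -ltNge.
have := HK q (dr (h1 s) q) (drr (h1 s) q) (drr (h2 s) q) (h1 s q) (h2 s q) qI1.
move=> /(_ (le_trans y1M M1M) (le_trans b2M M2M) b12 h21) H.
have {}H := H _ _.
suff: Falg p (dr (h1 s) q) (drr (h1 s) q) (sin (h1 s q)) (cos (h1 s q)) q -
    Falg p (dr (h1 s) q) (drr (h2 s) q) (sin (h2 s q)) (cos (h2 s q)) q <=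
    K * (h1 s q - h2 s q) by lra.
apply: H; last by rewrite -y12 -he2// (le_trans t2M).
move=> x; apply: sin_between => //.
- by case/andP: (b2 s q sT' qI').
- by case/andP: (b1 s q sT' qI').
- apply: (classical_le_linear p12 h0d h00 T0 s1 sT' _ qI1) => r' r'I.
  by have [_ H1 _] := HM1 s r' sT' r'I; apply: le_trans M1M.
Qed.

(** Near [0] the positive slope keeps [h0] above a line; away from [0] compactness gives a positive
    minimum, and the maximum of [h0] stays below [pi]. *)
Lemma initial_barrier {R : realType} (h0 : R -> R) :
  (forall r, @I01 R r -> derivable_in (@I01 R) h0 r) -> h0 0 = 0 ->
  (forall r : R, 0 < r <= 1 -> 0 < h0 r < pi) -> 0 < dr h0 0 ->
  exists2 d : R, 0 < d < 1 &
    forall r, 0 <= r <= 1 -> d * r <= h0 r <= pi - d * r.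
Proof.
move=> h0d h00 h0r l0; set l := dr h0 0 in l0.
have hd x : 0 <= x <= 1 -> has_der `[0, 1] h0 x (dr h0 x).
  by move=> xI; apply: derivable_in_has_der; apply: h0d; rewrite /I01 /= in_itv.
have hc := has_der_within_continuous hd.
have I0 : 0 <= (0 : R) <= 1 by rewrite lexx ler01.
have /has_derP H := hd 0 I0.
have [e e0 He] := H (l / 2) (divr_gt0 l0 (ltr0n _ 2)).
pose e1 := Num.min (e / 2) 1.
have e10 : 0 < e1 by rewrite lt_min divr_gt0//=.
have e11 : e1 <= 1 by rewrite ge_min lexx orbT.
have e1e : e1 < e.
  by have : e1 <= e / 2 by [rewrite ge_min lexx]; lra.
have [||c cI cmin] := @EVT_min _ h0 e1 1 => //.
  by apply: continuous_subspaceW hc; apply: itv_sub => //; lra.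
have [c' cI' cmax] := EVT_max ler01 hc.
rewrite !in_itv /= in cI cI'.
have m1 : 0 < h0 c by have := h0r c; lra.
have m2 : 0 < pi - h0 c'.
  have [->|c'0] := eqVneq c' 0; first by rewrite h00 subr0 pi_gt0.
  have c'p : 0 < c' by rewrite lt_neqAle eq_sym c'0; lra.
  by have := h0r c'; lra.
(* In order: the slope near [0], the minimum on [[e1, 1]], the gap between the maximum and [pi], and
   a bound forcing [d < 1]. *)
pose d := Num.min (Num.min (l / 2) (h0 c)) (Num.min (pi - h0 c') (1 / 2)).
have d0 : 0 < d by rewrite !lt_min m1 m2 !divr_gt0.
have d1 : d <= l / 2 by rewrite !ge_min lexx.
have d2 : d <= h0 c by rewrite !ge_min lexx orbT.
have d3 : d <= pi - h0 c' by rewrite !ge_min lexx !orbT.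
have d4 : d <= 1 / 2 by rewrite !ge_min lexx !orbT.
exists d => [|r rI]; first lra.
have rd : d * r <= d by rewrite ler_piMr//; lra.
have := cmax r; rewrite in_itv /= => /(_ rI) U.
have [re|re] := ltP r e1; last first.
  have := cmin r; rewrite in_itv /= => C.
  have {}C : h0 c <= h0 r by apply: C; lra.
  lra.
have := He r; rewrite h00 !subr0 (ger0_norm (_ : 0 <= r)) /= ?in_itv /=; last lra.
move=> Hr; have {}Hr : `|h0 r - l * r| <= l / 2 * r by apply: Hr; lra.
move: Hr; rewrite ler_norml => /andP[Hr _].
have : d * r <= l / 2 * r by rewrite ler_wpM2r//; lra.
lra.
Qed.

Lemma ereal_between {R : realType} (t : R) (T : \bar R) : (t%:E < T)%E ->
  exists2 T' : R, t < T' & (T'%:E < T)%E.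
Proof.
case: T => [T| |//]; first rewrite lte_fin => tT.
  by exists ((t + T) / 2); rewrite ?lte_fin; lra.
by move=> _; exists (t + 1); rewrite ?ltry//; lra.
Qed.

Unset Implicit Arguments.
Set Strict Implicit.

Theorem theorem1p2 (R : realType) (p : R) (h0 : R -> R)
    (hp : 1 < p < 2)
    (h0C2 : C2_I01 h0)
    (h0_0 : h0 0 = 0)
    (h0_range : forall r : R, 0 < r <= 1 -> 0 < h0 r < pi)
    (h0_slope : 0 < dr h0 0) :
  (forall (T1 T2 : \bar R) (h1 h2 : R -> R -> R),
     maximal_solution p h0 T1 h1 -> maximal_solution p h0 T2 h2 ->
     T1 = T2 /\
     forall t r : R, 0 <= t -> (t%:E < T1)%E -> 0 <= r <= 1 ->
       h1 t r = h2 t r)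
  /\
  (exists delta : R, 0 < delta < 1 /\
     forall (T : \bar R) (h : R -> R -> R), maximal_solution p h0 T h ->
       (forall t : R, 0 < t -> (t%:E < T)%E ->
          [/\ h t 0 = 0,
              forall r : R, 0 < r <= 1 ->
                delta * r <= h t r <= pi - delta * r
            & delta <= dr (h t) 0])
       /\
       (forall t : R, 0 <= t -> (t%:E < T)%E ->
          drr (h t) 0 = 0 /\ Fop p (h t) 1 = 0)).
Proof.
have h0d r : @I01 R r -> derivable_in (@I01 R) h0 r by case: h0C2 => H _ _; exact: H.
have h0d0 : derivable_in (@I01 R) h0 0 by apply: h0d; rewrite /I01 /= in_itv /= lexx ler01.
have [d d01 hb] := initial_barrier h0d h0_0 h0_range h0_slope.
(* Two solutions agree at every common time: both are classical up to some finite time beyond [t],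
   and comparison is applied in both directions. *)
have uniq (T1 T2 : \bar R) h1 h2 t r : solution_until p h0 T1 h1 ->
    solution_until p h0 T2 h2 -> 0 <= t -> (t%:E < T1)%E -> (t%:E < T2)%E ->
    0 <= r <= 1 -> h1 t r = h2 t r.
  move=> [_ s1] [_ s2] t0 /ereal_between[S1 tS1 ST1] /ereal_between[S2 tS2 ST2] rI.
  have S0 : 0 < Num.min S1 S2 by rewrite lt_min (le_lt_trans t0 tS1) (le_lt_trans t0 tS2).
  have tS : 0 <= t <= Num.min S1 S2 by rewrite t0 le_min !ltW.
  have {}s1 : classical_solution p h0 (Num.min S1 S2) h1.
    by apply: s1 => //; apply: le_lt_trans ST1; rewrite lee_fin ge_min lexx.
  have {}s2 : classical_solution p h0 (Num.min S1 S2) h2.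
    by apply: s2 => //; apply: le_lt_trans ST2; rewrite lee_fin ge_min lexx orbT.
  apply/eqP; rewrite eq_le (classical_le hp h0d0 h0_0 d01 hb S0 s1 s2 tS rI).
  exact: (classical_le hp h0d0 h0_0 d01 hb S0 s2 s1 tS rI).
split.
  move=> T1 T2 h1 h2 [s1 m1] [s2 m2].
  have T12 : T1 = T2.
    (* The solution with the longer lifetime extends the other, so maximality of the latter forces
       the lifetimes to be equal. *)
    have [T12|T21] := leP T1 T2.
      apply/le_anti/andP; split=> //; apply: (m1 _ h2) => // t r t0 tT rI.
      exact: (uniq _ _ _ _ _ _ s2 s1 t0 (lt_le_trans tT T12) tT rI).
    apply/le_anti/andP; split; last exact: ltW.
    apply: (m2 _ h1) => // t r t0 tT rI.
    exact: (uniq _ _ _ _ _ _ s1 s2 t0 (lt_trans tT T21) tT rI).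
  by split=> // t r t0 tT rI; apply: (uniq _ _ _ _ _ _ s1 s2 t0 tT _ rI); rewrite -T12.
exists d; split=> // T h [[_ s] _].
have key t : 0 <= t -> (t%:E < T)%E ->
    exists T', [/\ 0 < T', 0 <= t <= T' & classical_solution p h0 T' h].
  move=> t0 /ereal_between[T' tT' T'T]; have T'0 := le_lt_trans t0 tT'.
  by exists T'; split; [|rewrite t0 ltW|exact: s].
split=> t t0 tT.
  have [T' [T'0 tT' c]] := key t (ltW t0) tT; split.
  - exact: (classical_origin hp h0d0 h0_0 T'0 c tT').
  - move=> r /andP[r0 r1].
    by apply: (classical_barrier hp h0d0 h0_0 d01 hb T'0 c tT'); rewrite ltW.
  - exact: (classical_slope hp h0d0 h0_0 d01 hb T'0 c tT').
have [T' [T'0 tT' c]] := key t t0 tT; split.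
- exact: (classical_drr hp h0d0 h0_0 d01 hb T'0 c tT').
- exact: (classical_Fop1 T'0 c tT').
Qed.
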